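(* Let $\mathcal M$ be a minimal time-like surface of general type in $\mathbb R^4_2$ parametrized by canonical coordinates $(u,v)$. Then the Gauss curvature $K$ and the curvature of the normal connection $\varkappa$ of $\mathcal M$ satisfy the system \[ \sqrt[4]{|K^2-\varkappa^2|}\;\Delta^h\ln|K^2-\varkappa^2|=-8K,\qquad \sqrt[4]{|K^2-\varkappa^2|}\;\Delta^h\ln\left|\frac{K+\varkappa}{K-\varkappa}\right|=-4\varkappa,\qquad K^2-\varkappa^2\neq0, \] where $\Delta^h=\frac{\partial^2}{\partial u^2}-\frac{\partial^2}{\partial v^2}$. If $\hat{\mathcal M}$ is obtained from $\mathcal M$ through a proper motion $\hat x=Ax+b$, $A\in\mathbf{SO}(2,2,\mathbb R)$, $b\in\mathbb R^4_2$, then it generates the same solution $(K,\varkappa)$ of this system.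
   Context: All maps are smooth and domains are open and connected. $\mathbb R^4_2$ is $\mathbb R^4$ with scalar product $a\cdot b=-a_1b_1+a_2b_2-a_3b_3+a_4b_4$ and its standard orientation; $a^2=a\cdot a$. $\mathbf{SO}(2,2,\mathbb R)$ is the group of linear maps preserving the scalar product with determinant $1$. Double numbers: $\mathbb D=\{t=u+\mathrm jv:u,v\in\mathbb R\}$, $\mathrm j^2=1$, $\bar t=u-\mathrm jv$, $|t|^2=t\bar t=u^2-v^2$; $\mathbb D_0=\{t:|t|^2=0\}$; $\mathbb D_+=\{t:|t|^2>0,\ \mathrm{Re}\,t>0\}$; $\frac{\partial}{\partial t}=\frac12(\frac{\partial}{\partial u}+\mathrm j\frac{\partial}{\partial v})$. $\mathbb D^4_2$ is $\mathbb D^4$ with the $\mathbb D$-bilinear extension of the scalar product. A time-like surface $\mathcal M=(\mathcal D,x)$ in $\mathbb R^4_2$ is an immersion $x:\mathcal D\to\mathbb R^4_2$, $\mathcal D\subset\mathbb R^2$, whose induced scalar product on tangent planes is indefinite (signature $(1,1)$). Coordinates $(u,v)$ are isothermal if $x_u^2=-x_v^2$ and $x_u\cdot x_v=0$; always with $E=x_u^2<0$. Let $\sigma$ be the second fundamental form, $(X_1,X_2)$ an orthonormal tangent frame with $X_1^2=-1$, $X_2^2=1$, and $(n_1,n_2)$ an orthonormal normal frame with $n_1^2=-1$, $n_2^2=1$ such that $(X_1,X_2,n_1,n_2)$ is right (positively) oriented in $\mathbb R^4_2$. The surface is minimal if $H=\frac12(-\sigma(X_1,X_1)+\sigma(X_2,X_2))=0$.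 Gauss curvature: $K=-R(X_1,X_2)X_2\cdot X_1$; curvature of the normal connection: $\varkappa=R^N(X_1,X_2)n_2\cdot n_1$, where $R,R^N$ are the curvature tensors of the Levi-Civita and the normal connections, with $R(X,Y)=\nabla_X\nabla_Y-\nabla_Y\nabla_X-\nabla_{[X,Y]}$ (similarly $R^N$). For isothermal $t=u+\mathrm jv$ put $\Phi=x_u+\mathrm jx_v$ and $\Phi'=\partial\Phi/\partial t$; $\Phi'^\bot$ is the projection of $\Phi'$ to the complexified normal space (the $\mathbb D$-span of the normal space), along the complexified tangent space, and ${\Phi'^\bot}^2=\Phi'^\bot\cdot\Phi'^\bot\in\mathbb D$. A minimal time-like surface is of general type if ${\Phi'^\bot}^2\notin\mathbb D_0$ at every point. It is of the first type if ${\Phi'^\bot}^2\in\mathbb D_+$, of the second type if $-{\Phi'^\bot}^2\in\mathbb D_+$, of the third type if $\pm\mathrm j{\Phi'^\bot}^2\in\mathbb D_+$ (i.e. $|{\Phi'^\bot}^2|^2<0$). Isothermal coordinates with $E<0$ are canonical if ${\Phi'^\bot}^2=\varepsilon$, where $\varepsilon=1,-1,\mathrm j$ for surfaces of the first, second, third type, respectively. *)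

(* Defs.v *)
From Stdlib Require Import Reals.
From Coquelicot Require Import Coquelicot.
Open Scope R_scope.

(* Functions of the two real variables (u, v) are curried. *)

Definition d_u (f : R -> R -> R) (u v : R) : R := Derive (fun s => f s v) u.
Definition d_v (f : R -> R -> R) (u v : R) : R := Derive (fun s => f u s) v.

Definition smooth_at (f : R -> R -> R) (u v : R) : Prop :=
  forall n : nat, ex_diff_n f n u v.

Definition connected_set (Dom : R * R -> Prop) : Prop :=
  forall U V : R * R -> Prop,
    open U -> open V ->
    (forall p, Dom p -> U p \/ V p) ->
    (exists p, Dom p /\ U p) -> (exists p, Dom p /\ V p) ->
    exists p, Dom p /\ U p /\ V p.

Definition domain (Dom : R * R -> Prop) : Prop := open Dom /\ connected_set Dom.

Record dbl : Type := Dbl { dre : R; dim : R }.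

Definition dbl_of_R (a : R) : dbl := Dbl a 0.
Definition dbl_j : dbl := Dbl 0 1.
Definition dbl_add (s t : dbl) : dbl := Dbl (dre s + dre t) (dim s + dim t).
Definition dbl_opp (t : dbl) : dbl := Dbl (- dre t) (- dim t).
Definition dbl_mul (s t : dbl) : dbl :=
  Dbl (dre s * dre t + dim s * dim t) (dre s * dim t + dim s * dre t).
Definition dbl_conj (t : dbl) : dbl := Dbl (dre t) (- dim t).
(* |t|^2 = t * conj t, which is a real number of either sign. *)
Definition dbl_norm2 (t : dbl) : R := dre (dbl_mul t (dbl_conj t)).

Definition dbl_D0 (t : dbl) : Prop := dbl_norm2 t = 0.
Definition dbl_Dplus (t : dbl) : Prop := 0 < dbl_norm2 t /\ 0 < dre t.

(* d/dt = (d/du + j d/dv) / 2 *)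
Definition dbl_d_t (f : R -> R -> dbl) (u v : R) : dbl :=
  let re := fun a b => dre (f a b) in
  let im := fun a b => dim (f a b) in
  dbl_mul (dbl_of_R (/ 2))
    (dbl_add (Dbl (d_u re u v) (d_u im u v))
             (dbl_mul dbl_j (Dbl (d_v re u v) (d_v im u v)))).

(* [vec4 R] carries R^4_2 and [vec4 dbl] carries D^4_2. *)
Record vec4 (T : Type) : Type := Vec4 { c1 : T; c2 : T; c3 : T; c4 : T }.
Arguments Vec4 {T} c1 c2 c3 c4.
Arguments c1 {T} v.
Arguments c2 {T} v.
Arguments c3 {T} v.
Arguments c4 {T} v.

Definition vmap {S T : Type} (f : S -> T) (a : vec4 S) : vec4 T :=
  Vec4 (f (c1 a)) (f (c2 a)) (f (c3 a)) (f (c4 a)).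
Definition vmap2 {S T U : Type} (f : S -> T -> U) (a : vec4 S) (b : vec4 T) : vec4 U :=
  Vec4 (f (c1 a) (c1 b)) (f (c2 a) (c2 b)) (f (c3 a) (c3 b)) (f (c4 a) (c4 b)).

Definition vzero : vec4 R := Vec4 0 0 0 0.
Definition vadd (a b : vec4 R) : vec4 R := vmap2 Rplus a b.
Definition vsub (a b : vec4 R) : vec4 R := vmap2 Rminus a b.
Definition vscal (k : R) (a : vec4 R) : vec4 R := vmap (Rmult k) a.

Definition dot (a b : vec4 R) : R :=
  - (c1 a * c1 b) + c2 a * c2 b - c3 a * c3 b + c4 a * c4 b.

Definition dbl_dot (a b : vec4 dbl) : dbl :=
  dbl_add
    (dbl_add (dbl_opp (dbl_mul (c1 a) (c1 b))) (dbl_mul (c2 a) (c2 b)))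
    (dbl_add (dbl_opp (dbl_mul (c3 a) (c3 b))) (dbl_mul (c4 a) (c4 b))).

Definition det3 (a1 a2 a3 b1 b2 b3 d1 d2 d3 : R) : R :=
  a1 * (b2 * d3 - b3 * d2) - a2 * (b1 * d3 - b3 * d1) + a3 * (b1 * d2 - b2 * d1).

(* Laplace expansion along the first vector. *)
Definition det4 (a b c d : vec4 R) : R :=
  c1 a * det3 (c2 b) (c3 b) (c4 b) (c2 c) (c3 c) (c4 c) (c2 d) (c3 d) (c4 d)
  - c2 a * det3 (c1 b) (c3 b) (c4 b) (c1 c) (c3 c) (c4 c) (c1 d) (c3 d) (c4 d)
  + c3 a * det3 (c1 b) (c2 b) (c4 b) (c1 c) (c2 c) (c4 c) (c1 d) (c2 d) (c4 d)
  - c4 a * det3 (c1 b) (c2 b) (c3 b) (c1 c) (c2 c) (c3 c) (c1 d) (c2 d) (c3 d).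

Definition linear_map (A : vec4 R -> vec4 R) : Prop :=
  (forall a b, A (vadd a b) = vadd (A a) (A b)) /\
  (forall k a, A (vscal k a) = vscal k (A a)).

Definition det_map (A : vec4 R -> vec4 R) : R :=
  det4 (A (Vec4 1 0 0 0)) (A (Vec4 0 1 0 0)) (A (Vec4 0 0 1 0)) (A (Vec4 0 0 0 1)).

Definition SO22 (A : vec4 R -> vec4 R) : Prop :=
  linear_map A /\ (forall a b, dot (A a) (A b) = dot a b) /\ det_map A = 1.

Definition vfun := R -> R -> vec4 R.

Definition vd_u (w : vfun) (u v : R) : vec4 R :=
  Vec4 (d_u (fun a b => c1 (w a b)) u v) (d_u (fun a b => c2 (w a b)) u v)
       (d_u (fun a b => c3 (w a b)) u v) (d_u (fun a b => c4 (w a b)) u v).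
Definition vd_v (w : vfun) (u v : R) : vec4 R :=
  Vec4 (d_v (fun a b => c1 (w a b)) u v) (d_v (fun a b => c2 (w a b)) u v)
       (d_v (fun a b => c3 (w a b)) u v) (d_v (fun a b => c4 (w a b)) u v).

Definition vsmooth_at (w : vfun) (u v : R) : Prop :=
  smooth_at (fun a b => c1 (w a b)) u v /\ smooth_at (fun a b => c2 (w a b)) u v /\
  smooth_at (fun a b => c3 (w a b)) u v /\ smooth_at (fun a b => c4 (w a b)) u v.

Definition smooth_on (Dom : R * R -> Prop) (f : R -> R -> R) : Prop :=
  forall u v, Dom (u, v) -> smooth_at f u v.
Definition vsmooth_on (Dom : R * R -> Prop) (w : vfun) : Prop :=
  forall u v, Dom (u, v) -> vsmooth_at w u v.

Definition EE (x : vfun) (u v : R) : R := dot (vd_u x u v) (vd_u x u v).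
Definition FF (x : vfun) (u v : R) : R := dot (vd_u x u v) (vd_v x u v).
Definition GG (x : vfun) (u v : R) : R := dot (vd_v x u v) (vd_v x u v).

Definition immersion_at (x : vfun) (u v : R) : Prop :=
  forall a b : R,
    vadd (vscal a (vd_u x u v)) (vscal b (vd_v x u v)) = vzero -> a = 0 /\ b = 0.

(* On a plane, an indefinite scalar product has signature (1,1). *)
Definition indefinite_at (x : vfun) (u v : R) : Prop :=
  exists a b c d : R,
    let X := vadd (vscal a (vd_u x u v)) (vscal b (vd_v x u v)) in
    let Y := vadd (vscal c (vd_u x u v)) (vscal d (vd_v x u v)) in
    dot X X < 0 /\ 0 < dot Y Y.

Definition time_like_surface (Dom : R * R -> Prop) (x : vfun) : Prop :=
  domain Dom /\ vsmooth_on Dom x /\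
  forall u v, Dom (u, v) -> immersion_at x u v /\ indefinite_at x u v.

(* Tangential part: the tangent vector having the same scalar products with
   x_u and x_v as w. *)
Definition tan_part (x : vfun) (u v : R) (w : vec4 R) : vec4 R :=
  let E := EE x u v in
  let F := FF x u v in
  let G := GG x u v in
  let p := dot w (vd_u x u v) in
  let q := dot w (vd_v x u v) in
  vadd (vscal ((p * G - q * F) / (E * G - F * F)) (vd_u x u v))
       (vscal ((q * E - p * F) / (E * G - F * F)) (vd_v x u v)).
Definition nor_part (x : vfun) (u v : R) (w : vec4 R) : vec4 R :=
  vsub w (tan_part x u v w).

(* A tangent vector field is given by its coefficients with respect to d/du and
   d/dv; [push x X] is the same field as an R^4_2-valued function. *)
Definition tfield : Type := ((R -> R -> R) * (R -> R -> R))%type.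

Definition push (x : vfun) (X : tfield) : vfun :=
  fun u v => vadd (vscal (fst X u v) (vd_u x u v)) (vscal (snd X u v) (vd_v x u v)).

Definition dir (X : tfield) (f : R -> R -> R) : R -> R -> R :=
  fun u v => fst X u v * d_u f u v + snd X u v * d_v f u v.
Definition vdir (X : tfield) (w : vfun) : vfun :=
  fun u v => vadd (vscal (fst X u v) (vd_u w u v)) (vscal (snd X u v) (vd_v w u v)).

Definition bracket (X Y : tfield) : tfield :=
  ((fun u v => dir X (fst Y) u v - dir Y (fst X) u v),
   (fun u v => dir X (snd Y) u v - dir Y (snd X) u v)).

(* Gauss formula: the flat derivative of a tangent field splits into the
   Levi-Civita derivative (tangential part) and the second fundamental form
   (normal part).  The normal connection is the normal part of the flat
   derivative of a normal field. *)
Definition nabla_LC (x : vfun) (X : tfield) (Z : vfun) : vfun :=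
  fun u v => tan_part x u v (vdir X Z u v).
Definition second_form (x : vfun) (X Y : tfield) : vfun :=
  fun u v => nor_part x u v (vdir X (push x Y) u v).
Definition nabla_N (x : vfun) (X : tfield) (n : vfun) : vfun :=
  fun u v => nor_part x u v (vdir X n u v).

Definition curvature_tensor (nabla : tfield -> vfun -> vfun)
    (X Y : tfield) (Z : vfun) : vfun :=
  fun u v =>
    vsub (vsub (nabla X (nabla Y Z) u v) (nabla Y (nabla X Z) u v))
         (nabla (bracket X Y) Z u v).

Definition tangent_frame_near (x : vfun) (X1 X2 : tfield) (u0 v0 : R) : Prop :=
  locally_2d (fun u v =>
    (smooth_at (fst X1) u v /\ smooth_at (snd X1) u v /\
     smooth_at (fst X2) u v /\ smooth_at (snd X2) u v) /\
    dot (push x X1 u v) (push x X1 u v) = -1 /\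
    dot (push x X2 u v) (push x X2 u v) = 1 /\
    dot (push x X1 u v) (push x X2 u v) = 0) u0 v0.

Definition normal_frame_near (x : vfun) (n1 n2 : vfun) (u0 v0 : R) : Prop :=
  locally_2d (fun u v =>
    (vsmooth_at n1 u v /\ vsmooth_at n2 u v) /\
    (dot (n1 u v) (vd_u x u v) = 0 /\ dot (n1 u v) (vd_v x u v) = 0 /\
     dot (n2 u v) (vd_u x u v) = 0 /\ dot (n2 u v) (vd_v x u v) = 0) /\
    dot (n1 u v) (n1 u v) = -1 /\
    dot (n2 u v) (n2 u v) = 1 /\
    dot (n1 u v) (n2 u v) = 0) u0 v0.

Definition right_oriented_near (x : vfun) (X1 X2 : tfield) (n1 n2 : vfun)
    (u0 v0 : R) : Prop :=
  locally_2d (fun u v => 0 < det4 (push x X1 u v) (push x X2 u v) (n1 u v) (n2 u v))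
    u0 v0.

Definition mean_curvature (x : vfun) (X1 X2 : tfield) : vfun :=
  fun u v => vscal (/ 2) (vsub (second_form x X2 X2 u v) (second_form x X1 X1 u v)).

(* H, K and the normal curvature do not depend on the orthonormal frames, and
   smooth frames exist near every point.  Only one local frame is required at
   each point, so a hypothesis of this form covers every choice of frames. *)
Definition minimal (Dom : R * R -> Prop) (x : vfun) : Prop :=
  forall u v, Dom (u, v) ->
    exists X1 X2 : tfield,
      tangent_frame_near x X1 X2 u v /\ mean_curvature x X1 X2 u v = vzero.

Definition is_gauss_curvature (Dom : R * R -> Prop) (x : vfun) (K : R -> R -> R) : Prop :=
  forall u v, Dom (u, v) ->
    exists X1 X2 : tfield,
      tangent_frame_near x X1 X2 u v /\
      K u v = - dot (curvature_tensor (nabla_LC x) X1 X2 (push x X2) u v) (push x X1 u v).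

Definition is_normal_curvature (Dom : R * R -> Prop) (x : vfun)
    (kappa : R -> R -> R) : Prop :=
  forall u v, Dom (u, v) ->
    exists (X1 X2 : tfield) (n1 n2 : vfun),
      tangent_frame_near x X1 X2 u v /\ normal_frame_near x n1 n2 u v /\
      right_oriented_near x X1 X2 n1 n2 u v /\
      kappa u v = dot (curvature_tensor (nabla_N x) X1 X2 n2 u v) (n1 u v).

Definition isothermal (Dom : R * R -> Prop) (x : vfun) : Prop :=
  forall u v, Dom (u, v) ->
    EE x u v = - GG x u v /\ FF x u v = 0 /\ EE x u v < 0.

(* Phi = x_u + j x_v *)
Definition Phi (x : vfun) (u v : R) : vec4 dbl := vmap2 Dbl (vd_u x u v) (vd_v x u v).

Definition dPhi (x : vfun) (u v : R) : vec4 dbl :=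
  Vec4 (dbl_d_t (fun a b => c1 (Phi x a b)) u v) (dbl_d_t (fun a b => c2 (Phi x a b)) u v)
       (dbl_d_t (fun a b => c3 (Phi x a b)) u v) (dbl_d_t (fun a b => c4 (Phi x a b)) u v).

(* The projection a + j b |-> nor a + j (nor b) is the one onto the complexified
   normal space along the complexified tangent space. *)
Definition dbl_nor_part (x : vfun) (u v : R) (w : vec4 dbl) : vec4 dbl :=
  vmap2 Dbl (nor_part x u v (vmap dre w)) (nor_part x u v (vmap dim w)).

Definition dPhi_perp2 (x : vfun) (u v : R) : dbl :=
  dbl_dot (dbl_nor_part x u v (dPhi x u v)) (dbl_nor_part x u v (dPhi x u v)).

Definition general_type (Dom : R * R -> Prop) (x : vfun) : Prop :=
  forall u v, Dom (u, v) -> ~ dbl_D0 (dPhi_perp2 x u v).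
Definition first_type (Dom : R * R -> Prop) (x : vfun) : Prop :=
  forall u v, Dom (u, v) -> dbl_Dplus (dPhi_perp2 x u v).
Definition second_type (Dom : R * R -> Prop) (x : vfun) : Prop :=
  forall u v, Dom (u, v) -> dbl_Dplus (dbl_opp (dPhi_perp2 x u v)).
Definition third_type (Dom : R * R -> Prop) (x : vfun) : Prop :=
  forall u v, Dom (u, v) ->
    dbl_Dplus (dbl_mul dbl_j (dPhi_perp2 x u v)) \/
    dbl_Dplus (dbl_opp (dbl_mul dbl_j (dPhi_perp2 x u v))).

Definition canonical (Dom : R * R -> Prop) (x : vfun) (eps : dbl) : Prop :=
  isothermal Dom x /\
  ((first_type Dom x /\ eps = dbl_of_R 1) \/
   (second_type Dom x /\ eps = dbl_of_R (-1)) \/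
   (third_type Dom x /\ eps = dbl_j)) /\
  forall u v, Dom (u, v) -> dPhi_perp2 x u v = eps.

Definition minimal_general_canonical (Dom : R * R -> Prop) (x : vfun) (eps : dbl) : Prop :=
  time_like_surface Dom x /\ minimal Dom x /\
  general_type Dom x /\ canonical Dom x eps.

Definition hlaplacian (f : R -> R -> R) (u v : R) : R :=
  d_u (d_u f) u v - d_v (d_v f) u v.

Definition solves_system (Dom : R * R -> Prop) (K kappa : R -> R -> R) : Prop :=
  smooth_on Dom K /\ smooth_on Dom kappa /\
  forall u v, Dom (u, v) ->
    let Q := fun a b => K a b ^ 2 - kappa a b ^ 2 in
    let root4 := sqrt (sqrt (Rabs (Q u v))) in
    Q u v <> 0 /\
    root4 * hlaplacian (fun a b => ln (Rabs (Q a b))) u v = - 8 * K u v /\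
    root4 * hlaplacian
      (fun a b => ln (Rabs ((K a b + kappa a b) / (K a b - kappa a b)))) u v
      = - 4 * kappa u v.

Definition motion (A : vec4 R -> vec4 R) (b : vec4 R) (x : vfun) : vfun :=
  fun u v => vadd (A (x u v)) b.

(* Main.v *)
Require Import Defs.
From Stdlib Require Import Reals Lra Lia.
From Coquelicot Require Import Coquelicot.
(* [Reals] also declares [c1]; the coordinates of [vec4] take precedence. *)
Import Defs.
Open Scope R_scope.

(** Adding and subtracting the two coordinate derivatives of x gives vector
fields a = x_u + x_v ([null_plus]) and b = x_u - x_v ([null_minus]).
Isothermality makes them null, and minimality makes x a solution of the wave
equation x_uu = x_vv ([wave_equation]), so that a_v = a_u and b_v = - b_u: up
to a change of variables, a is a function of u + v alone and b one of u - v
alone.  Write a', b' for a_u, b_u.  The two idempotent components of the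
double number (Phi'^perp)^2 are a'.a' and b'.b', so in canonical coordinates
these are constants e and f, each equal to 1 or -1
([unit_null_derivatives_of_canonical]).

The tangential and the normal connection are both projections of the flat
derivative, and one computation, [curvature_of_projection], yields the Gauss
and the Ricci equations.  With E = x_u.x_u they become
K = - M / (2 E^3) ([gauss_value]) and kappa = - D / (2 E^3)
([normal_value]), where M = (a.b)(a'.b') - (a.b')(a'.b) is the scalar product
of the bivectors a^a' and b^b', and D = det(a, b, a', b').  No frame is left
in these expressions, and they do not change under proper motions; this is
the second half of the theorem.

For the system, the bivectors of R^4_2 split into two three-dimensional
Lorentzian spaces, as so(2,2) = so(1,2) + so(1,2), and M + D and M - D are
the scalar products of the corresponding halves of a^a' and b^b'
([dot_dual_half]).  In so(2,2) the bracket of a^a' and a^a'' is a multiple of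
a^a' by e, because a.a = a.a' = 0 and a.a'' = - e; since the projections onto
the halves respect brackets, each V among M + D, M - D satisfies Liouville's
equation Delta^h ln|V| = 4 e f / V ([dual_gram_liouville]).  A Gram
determinant gives (M + D)(M - D) = 4 e f E^2 ([dual_gram_product]), so
K^2 - kappa^2 = e f / E^4.  Hence ln|K^2 - kappa^2| and
ln|(K + kappa)/(K - kappa)| are, up to constants, -2 times the sum and 1 times
the difference of ln|M + D| and ln|M - D|, and the two Liouville equations
turn into the system. *)

(** * Smooth functions of two variables on an open set *)

Lemma open_locally_2d (U : R * R -> Prop) (u v : R) :
  open U -> U (u, v) -> locally_2d (fun a b => U (a, b)) u v.
Proof.
  intros HU Hp; apply locally_2d_locally.
  apply filter_imp with (2 := HU _ Hp); intros [a b]; exact (fun h => h).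
Qed.

(** A local frame is only given near a point; this lemma turns the
neighbourhood into an open set, on which all the calculus below is done. *)
Lemma locally_2d_open (P : R -> R -> Prop) (u v : R) :
  locally_2d P u v ->
  exists U : R * R -> Prop,
    open U /\ U (u, v) /\ forall a b, U (a, b) -> P a b.
Proof.
  intros HP.
  exists (fun p => locally p (fun z => P (fst z) (snd z))); split; [|split].
  - intros p Hp; apply locally_locally, Hp.
  - apply locally_2d_locally, HP.
  - intros a b H. exact (locally_singleton _ _ H).
Qed.

Lemma ex_derive_slices (f : R -> R -> R) (u v : R) :
  smooth_at f u v ->
  ex_derive (fun s => f s v) u /\ ex_derive (fun s => f u s) v.
Proof. intros H; destruct (H 1%nat) as (_ & H1 & H2 & _); auto. Qed.

Lemma smooth_at_cont (f : R -> R -> R) (u v : R) :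
  smooth_at f u v -> continuity_2d_pt f u v.
Proof. intros H; apply (H 0%nat). Qed.

Lemma d_u_ext (U : R * R -> Prop) (f g : R -> R -> R) (u v : R) :
  open U -> (forall a b, U (a, b) -> f a b = g a b) -> U (u, v) ->
  d_u f u v = d_u g u v.
Proof.
  intros HU E Hp; apply Derive_ext_loc.
  generalize (locally_2d_1d_const_y _ _ _ (open_locally_2d U u v HU Hp)).
  apply filter_imp; intros s; apply E.
Qed.

Lemma d_v_ext (U : R * R -> Prop) (f g : R -> R -> R) (u v : R) :
  open U -> (forall a b, U (a, b) -> f a b = g a b) -> U (u, v) ->
  d_v f u v = d_v g u v.
Proof.
  intros HU E Hp; apply Derive_ext_loc.
  generalize (locally_2d_1d_const_x _ _ _ (open_locally_2d U u v HU Hp)).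
  apply filter_imp; intros s; apply E.
Qed.

(** Smoothness is the conjunction of all the classes, but products and
inverses have to be treated one class at a time, since the derivative of f g
involves f and g themselves. *)
Definition class_on (U : R * R -> Prop) (n : nat) (f : R -> R -> R) : Prop :=
  forall u v, U (u, v) -> ex_diff_n f n u v.

Lemma class_on_S (U : R * R -> Prop) (n : nat) (f : R -> R -> R) :
  class_on U (S n) f ->
  class_on U n f /\ class_on U n (d_u f) /\ class_on U n (d_v f).
Proof.
  intros H; split; [|split]; intros u v Hp.
  - apply (ex_diff_n_m (S n)); [lia | auto].
  - apply (H u v Hp).
  - apply (H u v Hp).
Qed.

Lemma class_on_ext (U : R * R -> Prop) (n : nat) (f g : R -> R -> R) :
  open U -> (forall a b, U (a, b) -> f a b = g a b) ->
  class_on U n f -> class_on U n g.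
Proof.
  intros HU E H u v Hp; apply ex_diff_n_ext_loc with f; auto.
  apply locally_2d_impl with (2 := open_locally_2d U u v HU Hp).
  apply locally_2d_forall, E.
Qed.

Lemma class_on_intro (U : R * R -> Prop) (n : nat) (f fu fv : R -> R -> R) :
  open U ->
  (forall u v, U (u, v) ->
     continuity_2d_pt f u v /\ is_derive (fun s => f s v) u (fu u v) /\
     is_derive (fun s => f u s) v (fv u v)) ->
  class_on U n fu -> class_on U n fv -> class_on U (S n) f.
Proof.
  intros HU H Hu Hv u v Hp; destruct (H u v Hp) as (Hc & H1 & H2).
  split; [exact Hc|]; split; [eexists; exact H1|].
  split; [eexists; exact H2|]; split.
  - apply (class_on_ext U n fu); auto.
    intros a b Hab; symmetry; apply is_derive_unique, (H a b Hab).
  - apply (class_on_ext U n fv); auto.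
    intros a b Hab; symmetry; apply is_derive_unique, (H a b Hab).
Qed.

Lemma class_on_slices (U : R * R -> Prop) (n : nat) (f : R -> R -> R) (u v : R) :
  class_on U (S n) f -> U (u, v) ->
  continuity_2d_pt f u v /\ is_derive (fun s => f s v) u (d_u f u v) /\
  is_derive (fun s => f u s) v (d_v f u v).
Proof.
  intros H Hp; destruct (H u v Hp) as (Hc & H1 & H2 & _).
  split; [exact Hc|]; split; apply Derive_correct; assumption.
Qed.

Lemma class_on_const (U : R * R -> Prop) (n : nat) (c : R) :
  open U -> class_on U n (fun _ _ => c).
Proof.
  intros HU; revert c; induction n as [|n IH]; intros c.
  - intros u v _; split; [apply continuity_2d_pt_const | exact I].
  - apply (class_on_intro U n _ (fun _ _ => 0) (fun _ _ => 0)); auto.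
    intros u v _; split; [apply continuity_2d_pt_const|].
    split; apply (is_derive_const (K := R_AbsRing) (V := R_NormedModule)).
Qed.

Lemma class_on_plus (U : R * R -> Prop) (n : nat) (f g : R -> R -> R) :
  open U -> class_on U n f -> class_on U n g ->
  class_on U n (fun a b => f a b + g a b).
Proof.
  intros HU; revert f g; induction n as [|n IH]; intros f g Hf Hg.
  - intros u v Hp; split; [|exact I].
    apply continuity_2d_pt_plus; [apply (Hf u v Hp) | apply (Hg u v Hp)].
  - destruct (class_on_S _ _ _ Hf) as (_ & Hfu & Hfv).
    destruct (class_on_S _ _ _ Hg) as (_ & Hgu & Hgv).
    apply (class_on_intro U n _ (fun a b => d_u f a b + d_u g a b)
             (fun a b => d_v f a b + d_v g a b)); auto.
    intros u v Hp.
    destruct (class_on_slices U n f u v Hf Hp) as (Cf & Df & Ef).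
    destruct (class_on_slices U n g u v Hg Hp) as (Cg & Dg & Eg).
    split; [now apply continuity_2d_pt_plus|].
    split; now apply (is_derive_plus (K := R_AbsRing) (V := R_NormedModule)).
Qed.

Lemma class_on_mult (U : R * R -> Prop) (n : nat) (f g : R -> R -> R) :
  open U -> class_on U n f -> class_on U n g ->
  class_on U n (fun a b => f a b * g a b).
Proof.
  intros HU; revert f g; induction n as [|n IH]; intros f g Hf Hg.
  - intros u v Hp; split; [|exact I].
    apply continuity_2d_pt_mult; [apply (Hf u v Hp) | apply (Hg u v Hp)].
  - destruct (class_on_S _ _ _ Hf) as (Hf' & Hfu & Hfv).
    destruct (class_on_S _ _ _ Hg) as (Hg' & Hgu & Hgv).
    apply (class_on_intro U n _ (fun a b => d_u f a b * g a b + f a b * d_u g a b)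
             (fun a b => d_v f a b * g a b + f a b * d_v g a b)); auto;
      try (apply class_on_plus; auto).
    intros u v Hp.
    destruct (class_on_slices U n f u v Hf Hp) as (Cf & Df & Ef).
    destruct (class_on_slices U n g u v Hg Hp) as (Cg & Dg & Eg).
    split; [now apply continuity_2d_pt_mult|].
    split.
    + apply (is_derive_mult (fun s => f s v) (fun s => g s v)); auto; apply Rmult_comm.
    + apply (is_derive_mult (fun s => f u s) (fun s => g u s)); auto; apply Rmult_comm.
Qed.

(** The derivative of 1/f is - f' (1/f)^2, so one more derivative of 1/f costs
only the previous class of 1/f. *)
Lemma class_on_inv (U : R * R -> Prop) (n : nat) (f : R -> R -> R) :
  open U -> (forall u v, U (u, v) -> f u v <> 0) -> class_on U n f ->
  class_on U n (fun a b => / f a b).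
Proof.
  intros HU Hnz; induction n as [|n IH]; intros Hf.
  - intros u v Hp; split; [|exact I].
    apply continuity_2d_pt_inv; [apply (Hf u v Hp) | auto].
  - destruct (class_on_S _ _ _ Hf) as (Hf' & Hfu & Hfv).
    assert (Hi := IH Hf').
    apply (class_on_intro U n _ (fun a b => (-1 * d_u f a b) * (/ f a b * / f a b))
             (fun a b => (-1 * d_v f a b) * (/ f a b * / f a b))); auto.
    + intros u v Hp.
      destruct (class_on_slices U n f u v Hf Hp) as (Cf & Df & Ef).
      split; [now apply continuity_2d_pt_inv; auto|].
      assert (N := Hnz u v Hp).
      split.
      * replace (-1 * d_u f u v * (/ f u v * / f u v)) with (- d_u f u v / f u v ^ 2)
          by (field; exact N).
        apply (is_derive_inv (fun s => f s v)); auto.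
      * replace (-1 * d_v f u v * (/ f u v * / f u v)) with (- d_v f u v / f u v ^ 2)
          by (field; exact N).
        apply (is_derive_inv (fun s => f u s)); auto.
    + repeat apply class_on_mult; auto. now apply class_on_const.
    + repeat apply class_on_mult; auto. now apply class_on_const.
Qed.

Lemma smooth_on_class (U : R * R -> Prop) (f : R -> R -> R) :
  smooth_on U f <-> forall n, class_on U n f.
Proof.
  split; [intros H n u v Hp; apply (H u v Hp) | intros H u v Hp n; apply (H n u v Hp)].
Qed.

Lemma smooth_on_ext (U : R * R -> Prop) (f g : R -> R -> R) :
  open U -> (forall a b, U (a, b) -> f a b = g a b) -> smooth_on U f -> smooth_on U g.
Proof.
  rewrite !smooth_on_class; intros HU E H n; now apply (class_on_ext U n f).
Qed.

(** For a function with known partial derivatives, such as a logarithm. *)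
Lemma smooth_on_intro (U : R * R -> Prop) (f fu fv : R -> R -> R) :
  open U ->
  (forall u v, U (u, v) ->
     continuity_2d_pt f u v /\ is_derive (fun s => f s v) u (fu u v) /\
     is_derive (fun s => f u s) v (fv u v)) ->
  smooth_on U fu -> smooth_on U fv -> smooth_on U f.
Proof.
  rewrite !smooth_on_class; intros HU H Hu Hv n.
  apply (class_on_S U n f), (class_on_intro U n f fu fv); auto.
Qed.

Lemma smooth_on_const (U : R * R -> Prop) (c : R) :
  open U -> smooth_on U (fun _ _ => c).
Proof. rewrite smooth_on_class; intros HU n; now apply class_on_const. Qed.

Lemma smooth_on_plus (U : R * R -> Prop) (f g : R -> R -> R) :
  open U -> smooth_on U f -> smooth_on U g -> smooth_on U (fun a b => f a b + g a b).
Proof. rewrite !smooth_on_class; intros HU Hf Hg n; now apply class_on_plus. Qed.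

Lemma smooth_on_mult (U : R * R -> Prop) (f g : R -> R -> R) :
  open U -> smooth_on U f -> smooth_on U g -> smooth_on U (fun a b => f a b * g a b).
Proof. rewrite !smooth_on_class; intros HU Hf Hg n; now apply class_on_mult. Qed.

Lemma smooth_on_opp (U : R * R -> Prop) (f : R -> R -> R) :
  open U -> smooth_on U f -> smooth_on U (fun a b => - f a b).
Proof.
  intros HU Hf; apply (smooth_on_ext U (fun a b => -1 * f a b)); auto.
  - intros; ring.
  - apply smooth_on_mult; auto using smooth_on_const.
Qed.

Lemma smooth_on_minus (U : R * R -> Prop) (f g : R -> R -> R) :
  open U -> smooth_on U f -> smooth_on U g -> smooth_on U (fun a b => f a b - g a b).
Proof.
  intros HU Hf Hg; apply (smooth_on_plus U f (fun a b => - g a b)); auto using smooth_on_opp.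
Qed.

Lemma smooth_on_inv (U : R * R -> Prop) (f : R -> R -> R) :
  open U -> (forall u v, U (u, v) -> f u v <> 0) -> smooth_on U f ->
  smooth_on U (fun a b => / f a b).
Proof. rewrite !smooth_on_class; intros HU N H n; apply class_on_inv; auto. Qed.

Lemma smooth_on_div (U : R * R -> Prop) (f g : R -> R -> R) :
  open U -> (forall u v, U (u, v) -> g u v <> 0) -> smooth_on U f -> smooth_on U g ->
  smooth_on U (fun a b => f a b / g a b).
Proof. intros; apply smooth_on_mult; auto; now apply smooth_on_inv. Qed.

Lemma smooth_on_d_u (U : R * R -> Prop) (f : R -> R -> R) :
  smooth_on U f -> smooth_on U (d_u f).
Proof.
  rewrite !smooth_on_class; intros H n; now apply (class_on_S U n f).
Qed.

Lemma smooth_on_d_v (U : R * R -> Prop) (f : R -> R -> R) :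
  smooth_on U f -> smooth_on U (d_v f).
Proof.
  rewrite !smooth_on_class; intros H n; now apply (class_on_S U n f).
Qed.

Lemma d_u_const (c u v : R) : d_u (fun _ _ => c) u v = 0.
Proof. exact (Derive_const c _). Qed.

Lemma d_v_const (c u v : R) : d_v (fun _ _ => c) u v = 0.
Proof. exact (Derive_const c _). Qed.

Lemma d_u_plus (U : R * R -> Prop) (f g : R -> R -> R) (u v : R) :
  smooth_on U f -> smooth_on U g -> U (u, v) ->
  d_u (fun a b => f a b + g a b) u v = d_u f u v + d_u g u v.
Proof.
  intros Hf Hg Hp.
  exact (Derive_plus (fun s => f s v) (fun s => g s v) u (proj1 (ex_derive_slices f u v (Hf u v Hp))) (proj1 (ex_derive_slices g u v (Hg u v Hp)))).
Qed.

Lemma d_v_plus (U : R * R -> Prop) (f g : R -> R -> R) (u v : R) :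
  smooth_on U f -> smooth_on U g -> U (u, v) ->
  d_v (fun a b => f a b + g a b) u v = d_v f u v + d_v g u v.
Proof.
  intros Hf Hg Hp.
  exact (Derive_plus (fun s => f u s) (fun s => g u s) v (proj2 (ex_derive_slices f u v (Hf u v Hp))) (proj2 (ex_derive_slices g u v (Hg u v Hp)))).
Qed.

Lemma d_u_minus (U : R * R -> Prop) (f g : R -> R -> R) (u v : R) :
  smooth_on U f -> smooth_on U g -> U (u, v) ->
  d_u (fun a b => f a b - g a b) u v = d_u f u v - d_u g u v.
Proof.
  intros Hf Hg Hp.
  exact (Derive_minus (fun s => f s v) (fun s => g s v) u (proj1 (ex_derive_slices f u v (Hf u v Hp))) (proj1 (ex_derive_slices g u v (Hg u v Hp)))).
Qed.

Lemma d_v_minus (U : R * R -> Prop) (f g : R -> R -> R) (u v : R) :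
  smooth_on U f -> smooth_on U g -> U (u, v) ->
  d_v (fun a b => f a b - g a b) u v = d_v f u v - d_v g u v.
Proof.
  intros Hf Hg Hp.
  exact (Derive_minus (fun s => f u s) (fun s => g u s) v (proj2 (ex_derive_slices f u v (Hf u v Hp))) (proj2 (ex_derive_slices g u v (Hg u v Hp)))).
Qed.

Lemma d_u_opp (f : R -> R -> R) (u v : R) :
  d_u (fun a b => - f a b) u v = - d_u f u v.
Proof. apply (Derive_opp (fun s => f s v)). Qed.

Lemma d_v_opp (f : R -> R -> R) (u v : R) :
  d_v (fun a b => - f a b) u v = - d_v f u v.
Proof. apply (Derive_opp (fun s => f u s)). Qed.

Lemma d_u_mult (U : R * R -> Prop) (f g : R -> R -> R) (u v : R) :
  smooth_on U f -> smooth_on U g -> U (u, v) ->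
  d_u (fun a b => f a b * g a b) u v = d_u f u v * g u v + f u v * d_u g u v.
Proof.
  intros Hf Hg Hp.
  exact (Derive_mult (fun s => f s v) (fun s => g s v) u (proj1 (ex_derive_slices f u v (Hf u v Hp))) (proj1 (ex_derive_slices g u v (Hg u v Hp)))).
Qed.

Lemma d_v_mult (U : R * R -> Prop) (f g : R -> R -> R) (u v : R) :
  smooth_on U f -> smooth_on U g -> U (u, v) ->
  d_v (fun a b => f a b * g a b) u v = d_v f u v * g u v + f u v * d_v g u v.
Proof.
  intros Hf Hg Hp.
  exact (Derive_mult (fun s => f u s) (fun s => g u s) v (proj2 (ex_derive_slices f u v (Hf u v Hp))) (proj2 (ex_derive_slices g u v (Hg u v Hp)))).
Qed.

Lemma d_v_d_u (U : R * R -> Prop) (f : R -> R -> R) (u v : R) :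
  open U -> smooth_on U f -> U (u, v) -> d_v (d_u f) u v = d_u (d_v f) u v.
Proof.
  intros HU Hf Hp; symmetry; apply (Schwarz f).
  - apply locally_2d_impl with (2 := open_locally_2d U u v HU Hp).
    apply locally_2d_forall; intros a b Hab.
    assert (Hu := smooth_on_d_u U f Hf a b Hab).
    assert (Hv := smooth_on_d_v U f Hf a b Hab).
    split; [exact (proj1 (ex_derive_slices f a b (Hf a b Hab)))|].
    split; [exact (proj2 (ex_derive_slices f a b (Hf a b Hab)))|].
    split; [exact (proj1 (ex_derive_slices (d_v f) a b Hv))|].
    exact (proj2 (ex_derive_slices (d_u f) a b Hu)).
  - exact (smooth_at_cont (d_u (d_v f)) u v
             (smooth_on_d_u U _ (smooth_on_d_v U f Hf) u v Hp)).
  - exact (smooth_at_cont (d_v (d_u f)) u v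
             (smooth_on_d_v U _ (smooth_on_d_u U f Hf) u v Hp)).
Qed.

(** * Calculus of vector-valued functions *)

Lemma vec4_ext (a b : vec4 R) :
  c1 a = c1 b -> c2 a = c2 b -> c3 a = c3 b -> c4 a = c4 b -> a = b.
Proof. destruct a, b; simpl; congruence. Qed.

Ltac vec :=
  apply vec4_ext; cbv [vadd vsub vscal vmap vmap2 vzero]; cbn [c1 c2 c3 c4].

Lemma vsmooth_on_components (U : R * R -> Prop) (w : vfun) :
  vsmooth_on U w <->
  smooth_on U (fun a b => c1 (w a b)) /\ smooth_on U (fun a b => c2 (w a b)) /\
  smooth_on U (fun a b => c3 (w a b)) /\ smooth_on U (fun a b => c4 (w a b)).
Proof.
  split.
  - intros H; split; [|split; [|split]]; intros u v Hp; apply (H u v Hp).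
  - intros (H1 & H2 & H3 & H4) u v Hp; split; [|split; [|split]]; auto.
Qed.

Lemma smooth_on_c1 (U : R * R -> Prop) (w : vfun) :
  vsmooth_on U w -> smooth_on U (fun a b => c1 (w a b)).
Proof. intros H u v Hp; apply (H u v Hp). Qed.
Lemma smooth_on_c2 (U : R * R -> Prop) (w : vfun) :
  vsmooth_on U w -> smooth_on U (fun a b => c2 (w a b)).
Proof. intros H u v Hp; apply (H u v Hp). Qed.
Lemma smooth_on_c3 (U : R * R -> Prop) (w : vfun) :
  vsmooth_on U w -> smooth_on U (fun a b => c3 (w a b)).
Proof. intros H u v Hp; apply (H u v Hp). Qed.
Lemma smooth_on_c4 (U : R * R -> Prop) (w : vfun) :
  vsmooth_on U w -> smooth_on U (fun a b => c4 (w a b)).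
Proof. intros H u v Hp; apply (H u v Hp). Qed.

Ltac smooth_step :=
  match goal with
  | |- open _ => assumption
  | |- smooth_on _ _ => assumption
  | |- vsmooth_on _ _ => assumption
  | |- smooth_on _ (fun _ _ => ?c) => apply smooth_on_const
  | |- smooth_on _ (fun a b => _ + _) => apply smooth_on_plus
  | |- smooth_on _ (fun a b => _ - _) => apply smooth_on_minus
  | |- smooth_on _ (fun a b => _ * _) => apply smooth_on_mult
  | |- smooth_on _ (fun a b => - _) => apply smooth_on_opp
  | |- smooth_on _ (fun a b => _ / _) => apply smooth_on_div
  | |- smooth_on _ (fun a b => / _) => apply smooth_on_inv
  | |- smooth_on _ (fun a b => d_u _ a b) => apply smooth_on_d_u
  | |- smooth_on _ (fun a b => d_v _ a b) => apply smooth_on_d_v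
  | |- smooth_on _ (d_u _) => apply smooth_on_d_u
  | |- smooth_on _ (d_v _) => apply smooth_on_d_v
  | |- smooth_on _ (fun a b => c1 _) => apply smooth_on_c1
  | |- smooth_on _ (fun a b => c2 _) => apply smooth_on_c2
  | |- smooth_on _ (fun a b => c3 _) => apply smooth_on_c3
  | |- smooth_on _ (fun a b => c4 _) => apply smooth_on_c4
  end.

Ltac vsmooth :=
  intros; apply vsmooth_on_components;
  cbv [vadd vsub vscal vd_u vd_v vmap vmap2]; cbn [c1 c2 c3 c4];
  split; [|split; [|split]]; repeat smooth_step.

Lemma vsmooth_on_vadd (U : R * R -> Prop) (w z : vfun) :
  open U -> vsmooth_on U w -> vsmooth_on U z ->
  vsmooth_on U (fun a b => vadd (w a b) (z a b)).
Proof. vsmooth. Qed.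

Lemma vsmooth_on_vsub (U : R * R -> Prop) (w z : vfun) :
  open U -> vsmooth_on U w -> vsmooth_on U z ->
  vsmooth_on U (fun a b => vsub (w a b) (z a b)).
Proof. vsmooth. Qed.

Lemma vsmooth_on_vscal (U : R * R -> Prop) (f : R -> R -> R) (w : vfun) :
  open U -> smooth_on U f -> vsmooth_on U w ->
  vsmooth_on U (fun a b => vscal (f a b) (w a b)).
Proof. vsmooth. Qed.

Lemma vsmooth_on_vd_u (U : R * R -> Prop) (w : vfun) :
  vsmooth_on U w -> vsmooth_on U (vd_u w).
Proof. vsmooth. Qed.

Lemma vsmooth_on_vd_v (U : R * R -> Prop) (w : vfun) :
  vsmooth_on U w -> vsmooth_on U (vd_v w).
Proof. vsmooth. Qed.

Lemma smooth_on_dot (U : R * R -> Prop) (w z : vfun) :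
  open U -> vsmooth_on U w -> vsmooth_on U z ->
  smooth_on U (fun a b => dot (w a b) (z a b)).
Proof. intros; unfold dot; repeat smooth_step. Qed.

Lemma vsmooth_on_ext (U : R * R -> Prop) (w z : vfun) :
  open U -> (forall a b, U (a, b) -> w a b = z a b) -> vsmooth_on U w -> vsmooth_on U z.
Proof.
  intros HU E H; apply vsmooth_on_components.
  split; [|split; [|split]].
  - apply (smooth_on_ext U (fun a b => c1 (w a b))); repeat smooth_step.
    intros; now rewrite E.
  - apply (smooth_on_ext U (fun a b => c2 (w a b))); repeat smooth_step.
    intros; now rewrite E.
  - apply (smooth_on_ext U (fun a b => c3 (w a b))); repeat smooth_step.
    intros; now rewrite E.
  - apply (smooth_on_ext U (fun a b => c4 (w a b))); repeat smooth_step.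
    intros; now rewrite E.
Qed.

Lemma vd_u_ext (U : R * R -> Prop) (w z : vfun) (u v : R) :
  open U -> (forall a b, U (a, b) -> w a b = z a b) -> U (u, v) ->
  vd_u w u v = vd_u z u v.
Proof.
  intros HU E Hp; unfold vd_u; f_equal; apply (d_u_ext U); auto; intros; now rewrite E.
Qed.

Lemma vd_v_ext (U : R * R -> Prop) (w z : vfun) (u v : R) :
  open U -> (forall a b, U (a, b) -> w a b = z a b) -> U (u, v) ->
  vd_v w u v = vd_v z u v.
Proof.
  intros HU E Hp; unfold vd_v; f_equal; apply (d_v_ext U); auto; intros; now rewrite E.
Qed.

Ltac smooth_side := solve [assumption | repeat smooth_step].

Ltac deriv U :=
  repeat first
    [ rewrite (d_u_plus U) by smooth_side
    | rewrite (d_v_plus U) by smooth_side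
    | rewrite (d_u_minus U) by smooth_side
    | rewrite (d_v_minus U) by smooth_side
    | rewrite (d_u_mult U) by smooth_side
    | rewrite (d_v_mult U) by smooth_side
    | rewrite d_u_opp | rewrite d_v_opp | rewrite d_u_const | rewrite d_v_const ].

Lemma d_u_dot (U : R * R -> Prop) (w z : vfun) (u v : R) :
  open U -> vsmooth_on U w -> vsmooth_on U z -> U (u, v) ->
  d_u (fun a b => dot (w a b) (z a b)) u v
  = dot (vd_u w u v) (z u v) + dot (w u v) (vd_u z u v).
Proof.
  intros; unfold dot, vd_u; cbn [c1 c2 c3 c4]; deriv U; ring.
Qed.

Lemma d_v_dot (U : R * R -> Prop) (w z : vfun) (u v : R) :
  open U -> vsmooth_on U w -> vsmooth_on U z -> U (u, v) ->
  d_v (fun a b => dot (w a b) (z a b)) u v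
  = dot (vd_v w u v) (z u v) + dot (w u v) (vd_v z u v).
Proof.
  intros; unfold dot, vd_v; cbn [c1 c2 c3 c4]; deriv U; ring.
Qed.

Ltac vderiv U :=
  vec; cbv [vd_u vd_v]; cbn [c1 c2 c3 c4]; deriv U; try ring.

Lemma vd_u_vadd (U : R * R -> Prop) (w z : vfun) (u v : R) :
  open U -> vsmooth_on U w -> vsmooth_on U z -> U (u, v) ->
  vd_u (fun a b => vadd (w a b) (z a b)) u v = vadd (vd_u w u v) (vd_u z u v).
Proof. intros; vderiv U. Qed.

Lemma vd_v_vadd (U : R * R -> Prop) (w z : vfun) (u v : R) :
  open U -> vsmooth_on U w -> vsmooth_on U z -> U (u, v) ->
  vd_v (fun a b => vadd (w a b) (z a b)) u v = vadd (vd_v w u v) (vd_v z u v).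
Proof. intros; vderiv U. Qed.

Lemma vd_u_vsub (U : R * R -> Prop) (w z : vfun) (u v : R) :
  open U -> vsmooth_on U w -> vsmooth_on U z -> U (u, v) ->
  vd_u (fun a b => vsub (w a b) (z a b)) u v = vsub (vd_u w u v) (vd_u z u v).
Proof. intros; vderiv U. Qed.

Lemma vd_v_vsub (U : R * R -> Prop) (w z : vfun) (u v : R) :
  open U -> vsmooth_on U w -> vsmooth_on U z -> U (u, v) ->
  vd_v (fun a b => vsub (w a b) (z a b)) u v = vsub (vd_v w u v) (vd_v z u v).
Proof. intros; vderiv U. Qed.

Lemma vd_u_vscal (U : R * R -> Prop) (f : R -> R -> R) (w : vfun) (u v : R) :
  open U -> smooth_on U f -> vsmooth_on U w -> U (u, v) ->
  vd_u (fun a b => vscal (f a b) (w a b)) u v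
  = vadd (vscal (d_u f u v) (w u v)) (vscal (f u v) (vd_u w u v)).
Proof. intros; vderiv U. Qed.

Lemma vd_v_vscal (U : R * R -> Prop) (f : R -> R -> R) (w : vfun) (u v : R) :
  open U -> smooth_on U f -> vsmooth_on U w -> U (u, v) ->
  vd_v (fun a b => vscal (f a b) (w a b)) u v
  = vadd (vscal (d_v f u v) (w u v)) (vscal (f u v) (vd_v w u v)).
Proof. intros; vderiv U. Qed.

Lemma vd_v_vd_u (U : R * R -> Prop) (w : vfun) (u v : R) :
  open U -> vsmooth_on U w -> U (u, v) -> vd_v (vd_u w) u v = vd_u (vd_v w) u v.
Proof.
  intros HU H Hp; unfold vd_u, vd_v; cbn [c1 c2 c3 c4].
  f_equal; apply (d_v_d_u U); smooth_side.
Qed.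

(** * Curvature of a connection obtained by projecting the flat derivative *)

Lemma dot_sym (a b : vec4 R) : dot a b = dot b a.
Proof. unfold dot; ring. Qed.

Lemma dot_vadd_l (a b c : vec4 R) : dot (vadd a b) c = dot a c + dot b c.
Proof. unfold dot, vadd, vmap2; cbn [c1 c2 c3 c4]; ring. Qed.

Lemma dot_vsub_l (a b c : vec4 R) : dot (vsub a b) c = dot a c - dot b c.
Proof. unfold dot, vsub, vmap2; cbn [c1 c2 c3 c4]; ring. Qed.

Lemma dot_vscal_l (k : R) (a b : vec4 R) : dot (vscal k a) b = k * dot a b.
Proof. unfold dot, vscal, vmap; cbn [c1 c2 c3 c4]; ring. Qed.

Lemma dot_vadd_r (a b c : vec4 R) : dot a (vadd b c) = dot a b + dot a c.
Proof. unfold dot, vadd, vmap2; cbn [c1 c2 c3 c4]; ring. Qed.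

Lemma dot_vsub_r (a b c : vec4 R) : dot a (vsub b c) = dot a b - dot a c.
Proof. unfold dot, vsub, vmap2; cbn [c1 c2 c3 c4]; ring. Qed.

Lemma dot_vscal_r (k : R) (a b : vec4 R) : dot a (vscal k b) = k * dot a b.
Proof. unfold dot, vscal, vmap; cbn [c1 c2 c3 c4]; ring. Qed.

Ltac dots := rewrite ?dot_vadd_l, ?dot_vsub_l, ?dot_vscal_l, ?dot_vadd_r, ?dot_vsub_r, ?dot_vscal_r.

Definition tfield_smooth_on (U : R * R -> Prop) (X : tfield) : Prop :=
  smooth_on U (fst X) /\ smooth_on U (snd X).

Lemma vsmooth_on_vdir (U : R * R -> Prop) (X : tfield) (w : vfun) :
  open U -> tfield_smooth_on U X -> vsmooth_on U w -> vsmooth_on U (vdir X w).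
Proof.
  intros HU (H1 & H2) Hw.
  apply vsmooth_on_vadd; auto; apply vsmooth_on_vscal; auto.
  - now apply vsmooth_on_vd_u.
  - now apply vsmooth_on_vd_v.
Qed.

Lemma dir_dot (U : R * R -> Prop) (X : tfield) (w z : vfun) (u v : R) :
  open U -> vsmooth_on U w -> vsmooth_on U z -> U (u, v) ->
  dir X (fun a b => dot (w a b) (z a b)) u v
  = dot (vdir X w u v) (z u v) + dot (w u v) (vdir X z u v).
Proof.
  intros; unfold dir, vdir; rewrite (d_u_dot U), (d_v_dot U) by assumption; dots; ring.
Qed.

Lemma vdir_vsub (U : R * R -> Prop) (X : tfield) (w z : vfun) (u v : R) :
  open U -> vsmooth_on U w -> vsmooth_on U z -> U (u, v) ->
  vdir X (fun a b => vsub (w a b) (z a b)) u v = vsub (vdir X w u v) (vdir X z u v).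
Proof.
  intros; unfold vdir; rewrite (vd_u_vsub U), (vd_v_vsub U) by assumption; vec; ring.
Qed.

Lemma vdir_ext (U : R * R -> Prop) (X : tfield) (w z : vfun) (u v : R) :
  open U -> (forall a b, U (a, b) -> w a b = z a b) -> U (u, v) ->
  vdir X w u v = vdir X z u v.
Proof.
  intros; unfold vdir; now rewrite (vd_u_ext U w z), (vd_v_ext U w z).
Qed.

(** The formula is used twice: for flatness of R^4_2, and, with w = x, for the
derivative of a tangent field, as [push x Y] is [vdir Y x] by definition. *)
Lemma vdir_vdir (U : R * R -> Prop) (X Y : tfield) (w : vfun) (u v : R) :
  open U -> tfield_smooth_on U Y -> vsmooth_on U w -> U (u, v) ->
  vdir X (vdir Y w) u v
  = vadd (vadd (vscal (dir X (fst Y) u v) (vd_u w u v)) (vscal (dir X (snd Y) u v) (vd_v w u v)))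
      (vadd (vscal (fst Y u v) (vdir X (vd_u w) u v)) (vscal (snd Y u v) (vdir X (vd_v w) u v))).
Proof.
  intros HU (Y1 & Y2) Hw Hp.
  assert (Hu := vsmooth_on_vd_u U w Hw). assert (Hv := vsmooth_on_vd_v U w Hw).
  unfold vdir at 1.
  change (vdir Y w) with
    (fun a b => vadd (vscal (fst Y a b) (vd_u w a b)) (vscal (snd Y a b) (vd_v w a b))).
  rewrite (vd_u_vadd U), (vd_v_vadd U) by auto using vsmooth_on_vscal.
  rewrite !(vd_u_vscal U), !(vd_v_vscal U) by auto.
  unfold dir, vdir; vec; ring.
Qed.

(** The second derivatives cancel by Schwarz's theorem and the first ones
against the bracket. *)
Lemma flat_curvature (U : R * R -> Prop) (X Y : tfield) (w : vfun) (u v : R) :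
  open U -> tfield_smooth_on U X -> tfield_smooth_on U Y -> vsmooth_on U w -> U (u, v) ->
  vsub (vsub (vdir X (vdir Y w) u v) (vdir Y (vdir X w) u v)) (vdir (bracket X Y) w u v)
  = vzero.
Proof.
  intros HU SX SY Hw Hp; rewrite !(vdir_vdir U) by assumption.
  unfold bracket, vdir, dir; cbn [fst snd].
  rewrite (vd_v_vd_u U w) by assumption.
  vec; ring.
Qed.

(** Common source of the Gauss and the Ricci equations.  The connection is
P(D_X Z) with P + P' = 1 and W orthogonal to the image of P'.  Replacing
P(D_Y Z) by D_Y Z - P'(D_Y Z) leaves the flat curvature, which vanishes, and
derivatives of sections of the image of P'; differentiating their zero
product with W moves the derivative to W. *)
Lemma curvature_of_projection (U : R * R -> Prop)
    (P P' : R -> R -> vec4 R -> vec4 R) (X Y : tfield) (Z W : vfun) (u v : R) :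
  open U -> U (u, v) ->
  (forall a b w, U (a, b) -> P a b w = vsub w (P' a b w)) ->
  (forall a b w, U (a, b) -> dot (P' a b w) (W a b) = 0) ->
  (forall w, vsmooth_on U w -> vsmooth_on U (fun a b => P' a b (w a b))) ->
  tfield_smooth_on U X -> tfield_smooth_on U Y -> vsmooth_on U Z -> vsmooth_on U W ->
  dot (curvature_tensor (fun X Z a b => P a b (vdir X Z a b)) X Y Z u v) (W u v)
  = dot (P' u v (vdir Y Z u v)) (vdir X W u v) - dot (P' u v (vdir X Z u v)) (vdir Y W u v).
Proof.
  intros HU Hp HP HW HS SX SY SZ SW.
  assert (E : forall V T : tfield, tfield_smooth_on U V ->
    dot (P u v (vdir T (fun a b => P a b (vdir V Z a b)) u v)) (W u v)
    = dot (vdir T (vdir V Z) u v) (W u v) + dot (P' u v (vdir V Z u v)) (vdir T W u v)).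
  { intros V T HV.
    assert (SV := vsmooth_on_vdir U V Z HU HV SZ).
    rewrite HP, dot_vsub_l, HW by assumption.
    rewrite (vdir_ext U T _ (fun a b => vsub (vdir V Z a b) (P' a b (vdir V Z a b)))) by auto.
    rewrite (vdir_vsub U) by auto.
    assert (D := dir_dot U T (fun a b => P' a b (vdir V Z a b)) W u v HU (HS _ SV) SW Hp).
    assert (D0 : dir T (fun a b => dot (P' a b (vdir V Z a b)) (W a b)) u v = 0).
    { unfold dir.
      rewrite (d_u_ext U _ (fun _ _ => 0)), (d_v_ext U _ (fun _ _ => 0)), d_u_const, d_v_const by auto.
      ring. }
    cbv beta in D; rewrite D0 in D; dots; lra. }
  unfold curvature_tensor.
  rewrite !dot_vsub_l, !E by assumption.
  rewrite HP, dot_vsub_l, HW by assumption.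
  assert (F := f_equal (fun t => dot t (W u v)) (flat_curvature U X Y Z u v HU SX SY SZ Hp)).
  cbv beta in F; rewrite !dot_vsub_l in F.
  replace (dot vzero (W u v)) with 0 in F by (unfold dot, vzero; cbn [c1 c2 c3 c4]; ring).
  lra.
Qed.

(** * Isothermal coordinates and the wave equation *)

Lemma tan_part_isothermal (Dom : R * R -> Prop) (x : vfun) (u v : R) (w : vec4 R) :
  isothermal Dom x -> Dom (u, v) ->
  tan_part x u v w
  = vsub (vscal (dot w (vd_u x u v) / EE x u v) (vd_u x u v))
         (vscal (dot w (vd_v x u v) / EE x u v) (vd_v x u v)).
Proof.
  intros H Hp; destruct (H u v Hp) as (H1 & H2 & H3).
  unfold tan_part; cbv zeta; rewrite H2; replace (GG x u v) with (- EE x u v) by lra.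
  vec; field; lra.
Qed.

Lemma dot_nor_part (Dom : R * R -> Prop) (x : vfun) (u v : R) (w z : vec4 R) :
  isothermal Dom x -> Dom (u, v) ->
  dot (nor_part x u v w) z
  = dot w z - (dot w (vd_u x u v) * dot z (vd_u x u v)
               - dot w (vd_v x u v) * dot z (vd_v x u v)) / EE x u v.
Proof.
  intros H Hp; unfold nor_part; rewrite (tan_part_isothermal Dom) by assumption.
  destruct (H u v Hp) as (H1 & H2 & H3).
  dots; rewrite (dot_sym (vd_u x u v) z), (dot_sym (vd_v x u v) z).
  field; lra.
Qed.

Lemma dot_nor_part_tangent (Dom : R * R -> Prop) (x : vfun) (u v : R) (w : vec4 R) :
  isothermal Dom x -> Dom (u, v) ->
  dot (nor_part x u v w) (vd_u x u v) = 0 /\ dot (nor_part x u v w) (vd_v x u v) = 0.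
Proof.
  intros H Hp; rewrite !(dot_nor_part Dom) by assumption.
  destruct (H u v Hp) as (H1 & H2 & H3); unfold EE, FF, GG in *.
  rewrite (dot_sym (vd_v x u v) (vd_u x u v)), H2.
  replace (dot (vd_v x u v) (vd_v x u v)) with (- dot (vd_u x u v) (vd_u x u v)) by lra.
  split; field; lra.
Qed.

Lemma nor_part_vadd (x : vfun) (u v : R) (w z : vec4 R) :
  nor_part x u v (vadd w z) = vadd (nor_part x u v w) (nor_part x u v z).
Proof.
  unfold nor_part, tan_part; cbv zeta; rewrite !dot_vadd_l; unfold Rdiv; vec; ring.
Qed.

Lemma nor_part_vscal (x : vfun) (u v k : R) (w : vec4 R) :
  nor_part x u v (vscal k w) = vscal k (nor_part x u v w).
Proof.
  unfold nor_part, tan_part; cbv zeta; rewrite !dot_vscal_l; unfold Rdiv; vec; ring.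
Qed.

Lemma nor_part_tangent (Dom : R * R -> Prop) (x : vfun) (u v : R) :
  isothermal Dom x -> Dom (u, v) ->
  nor_part x u v (vd_u x u v) = vzero /\ nor_part x u v (vd_v x u v) = vzero.
Proof.
  intros H Hp; unfold nor_part; rewrite !(tan_part_isothermal Dom) by assumption.
  destruct (H u v Hp) as (H1 & H2 & H3); unfold EE, FF, GG in *.
  rewrite (dot_sym (vd_v x u v) (vd_u x u v)), H2.
  replace (dot (vd_v x u v) (vd_v x u v)) with (- dot (vd_u x u v) (vd_u x u v)) by lra.
  split; vec; field; lra.
Qed.

Lemma vsmooth_on_tan_part (Dom U : R * R -> Prop) (x w : vfun) :
  isothermal Dom x -> open U -> (forall a b, U (a, b) -> Dom (a, b)) ->
  vsmooth_on U x -> vsmooth_on U w -> vsmooth_on U (fun a b => tan_part x a b (w a b)).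
Proof.
  intros H HU HD Sx Sw.
  assert (Su := vsmooth_on_vd_u U x Sx); assert (Sv := vsmooth_on_vd_v U x Sx).
  assert (SE : smooth_on U (fun a b => EE x a b)) by now apply smooth_on_dot.
  assert (NE : forall a b, U (a, b) -> EE x a b <> 0).
  { intros a b Hab; destruct (H a b (HD a b Hab)); lra. }
  apply (vsmooth_on_ext U (fun a b =>
    vsub (vscal (dot (w a b) (vd_u x a b) / EE x a b) (vd_u x a b))
         (vscal (dot (w a b) (vd_v x a b) / EE x a b) (vd_v x a b)))); auto.
  - intros a b Hab; symmetry; apply (tan_part_isothermal Dom); auto.
  - apply vsmooth_on_vsub; auto; apply vsmooth_on_vscal; auto;
      apply smooth_on_div; auto; now apply smooth_on_dot.
Qed.

Lemma vsmooth_on_nor_part (Dom U : R * R -> Prop) (x w : vfun) :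
  isothermal Dom x -> open U -> (forall a b, U (a, b) -> Dom (a, b)) ->
  vsmooth_on U x -> vsmooth_on U w -> vsmooth_on U (fun a b => nor_part x a b (w a b)).
Proof.
  intros; apply vsmooth_on_vsub; auto; now apply (vsmooth_on_tan_part Dom).
Qed.

(** These are the derivatives of x_u.x_u = - x_v.x_v and x_u.x_v = 0. *)
Lemma isothermal_second_derivatives (U : R * R -> Prop) (x : vfun) (u v : R) :
  open U -> vsmooth_on U x -> isothermal U x -> U (u, v) ->
  dot (vd_u (vd_u x) u v) (vd_u x u v) = - dot (vd_u (vd_v x) u v) (vd_v x u v) /\
  dot (vd_u (vd_v x) u v) (vd_u x u v) = - dot (vd_v (vd_v x) u v) (vd_v x u v) /\
  dot (vd_u (vd_u x) u v) (vd_v x u v) = - dot (vd_u (vd_v x) u v) (vd_u x u v) /\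
  dot (vd_u (vd_v x) u v) (vd_v x u v) = - dot (vd_v (vd_v x) u v) (vd_u x u v).
Proof.
  intros HU Sx Hi Hp.
  assert (Su := vsmooth_on_vd_u U x Sx); assert (Sv := vsmooth_on_vd_v U x Sx).
  assert (C := vd_v_vd_u U x u v HU Sx Hp).
  assert (E1 : d_u (EE x) u v = d_u (fun a b => - GG x a b) u v).
  { apply (d_u_ext U); auto; intros a b Hab; apply (Hi a b Hab). }
  assert (E2 : d_v (EE x) u v = d_v (fun a b => - GG x a b) u v).
  { apply (d_v_ext U); auto; intros a b Hab; apply (Hi a b Hab). }
  assert (E3 : d_u (FF x) u v = d_u (fun _ _ => 0) u v).
  { apply (d_u_ext U); auto; intros a b Hab; apply (Hi a b Hab). }
  assert (E4 : d_v (FF x) u v = d_v (fun _ _ => 0) u v).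
  { apply (d_v_ext U); auto; intros a b Hab; apply (Hi a b Hab). }
  rewrite d_u_opp in E1; rewrite d_v_opp in E2; rewrite d_u_const in E3; rewrite d_v_const in E4.
  unfold EE, GG in E1, E2; unfold FF in E3, E4.
  rewrite (d_u_dot U (vd_u x) (vd_u x)), (d_u_dot U (vd_v x) (vd_v x)) in E1 by auto.
  rewrite (d_v_dot U (vd_u x) (vd_u x)), (d_v_dot U (vd_v x) (vd_v x)) in E2 by auto.
  rewrite (d_u_dot U (vd_u x) (vd_v x)) in E3 by auto.
  rewrite (d_v_dot U (vd_u x) (vd_v x)) in E4 by auto.
  rewrite C in E2, E4.
  rewrite (dot_sym (vd_u x u v) (vd_u (vd_u x) u v)), (dot_sym (vd_v x u v) (vd_u (vd_v x) u v)) in E1.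
  rewrite (dot_sym (vd_u x u v) (vd_u (vd_v x) u v)), (dot_sym (vd_v x u v) (vd_v (vd_v x) u v)) in E2.
  rewrite (dot_sym (vd_u x u v) (vd_u (vd_v x) u v)) in E3.
  rewrite (dot_sym (vd_u x u v) (vd_v (vd_v x) u v)) in E4.
  lra.
Qed.

(** The second fundamental form is bilinear over functions: the derivatives
of the coefficients of Y only contribute tangent vectors. *)
Lemma nor_vdir_push (Dom U : R * R -> Prop) (x : vfun) (X Y : tfield) (u v : R) :
  isothermal Dom x -> open U -> (forall a b, U (a, b) -> Dom (a, b)) ->
  vsmooth_on U x -> tfield_smooth_on U Y -> U (u, v) ->
  nor_part x u v (vdir X (push x Y) u v)
  = vadd (vadd (vscal (fst X u v * fst Y u v) (nor_part x u v (vd_u (vd_u x) u v)))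
               (vscal (snd X u v * snd Y u v) (nor_part x u v (vd_v (vd_v x) u v))))
         (vscal (fst X u v * snd Y u v + snd X u v * fst Y u v)
                (nor_part x u v (vd_u (vd_v x) u v))).
Proof.
  intros Hi HU HD Sx SY Hp; change (push x Y) with (vdir Y x).
  destruct (nor_part_tangent Dom x u v Hi (HD u v Hp)) as (Nu & Nv).
  rewrite (vdir_vdir U) by assumption; unfold vdir.
  rewrite !nor_part_vadd, !nor_part_vscal, !nor_part_vadd, !nor_part_vscal, Nu, Nv.
  rewrite (vd_v_vd_u U) by assumption; vec; ring.
Qed.

(** In a Lorentzian plane the second vector of an orthonormal pair is
determined by the first one up to sign; in isothermal coordinates it is
obtained by exchanging the two coefficients.  The sign t is the normalised
determinant of the pair. *)
Lemma orthonormal_pair (E a b c d : R) :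
  E < 0 -> E * (a ^ 2 - b ^ 2) = -1 -> E * (c ^ 2 - d ^ 2) = 1 -> a * c - b * d = 0 ->
  exists t, t * t = 1 /\ c = t * b /\ d = t * a.
Proof.
  intros HE H1 H2 H3; exists (- E * (a * d - b * c)); split; [|split].
  - replace (- E * (a * d - b * c) * (- E * (a * d - b * c)))
      with (E ^ 2 * (a * c - b * d) ^ 2 - (E * (a ^ 2 - b ^ 2)) * (E * (c ^ 2 - d ^ 2))) by ring.
    rewrite H1, H2, H3; ring.
  - replace (- E * (a * d - b * c) * b)
      with (- (E * (a ^ 2 - b ^ 2)) * c + E * a * (a * c - b * d)) by ring.
    rewrite H1, H3; ring.
  - replace (- E * (a * d - b * c) * a)
      with (- (E * (a ^ 2 - b ^ 2)) * d + E * b * (a * c - b * d)) by ring.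
    rewrite H1, H3; ring.
Qed.

Lemma tangent_frame_coefficients (Dom : R * R -> Prop) (x : vfun) (X1 X2 : tfield) (u v : R) :
  isothermal Dom x -> Dom (u, v) -> tangent_frame_near x X1 X2 u v ->
  EE x u v * (fst X1 u v ^ 2 - snd X1 u v ^ 2) = -1 /\
  exists t, t * t = 1 /\ fst X2 u v = t * snd X1 u v /\ snd X2 u v = t * fst X1 u v.
Proof.
  intros Hi Hp HF; destruct (Hi u v Hp) as (H1 & H2 & H3).
  destruct (locally_2d_singleton _ _ _ HF) as (_ & F1 & F2 & F3).
  unfold push in F1, F2, F3; unfold EE, FF, GG in *.
  revert F1 F2 F3; dots; rewrite (dot_sym (vd_v x u v) (vd_u x u v)), H2; intros F1 F2 F3.
  replace (dot (vd_v x u v) (vd_v x u v)) with (- dot (vd_u x u v) (vd_u x u v)) in F1, F2, F3 by lra.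
  assert (G1 : dot (vd_u x u v) (vd_u x u v) * (fst X1 u v ^ 2 - snd X1 u v ^ 2) = -1) by lra.
  split; [exact G1|].
  apply (orthonormal_pair (dot (vd_u x u v) (vd_u x u v))); try lra.
  apply (Rmult_eq_reg_l (dot (vd_u x u v) (vd_u x u v))); lra.
Qed.

Lemma vsub_eq_vzero (a b : vec4 R) : vsub a b = vzero -> a = b.
Proof.
  intros H; apply vec4_ext; apply Rminus_diag_uniq.
  - exact (f_equal c1 H).
  - exact (f_equal c2 H).
  - exact (f_equal c3 H).
  - exact (f_equal c4 H).
Qed.

(** By [orthonormal_pair] the mean curvature is a nonzero multiple of the
normal part of x_uu - x_vv; the tangential part of x_uu - x_vv vanishes
already by isothermality. *)
Lemma wave_equation (Dom : R * R -> Prop) (x : vfun) (u v : R) :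
  open Dom -> vsmooth_on Dom x -> isothermal Dom x -> minimal Dom x -> Dom (u, v) ->
  vd_v (vd_v x) u v = vd_u (vd_u x) u v.
Proof.
  intros HU Sx Hi Hm Hp.
  destruct (isothermal_second_derivatives Dom x u v HU Sx Hi Hp) as (D1 & D2 & D3 & D4).
  destruct (Hm u v Hp) as (X1 & X2 & HF & HM).
  destruct (tangent_frame_coefficients Dom x X1 X2 u v Hi Hp HF) as (C1 & t & Ht & C2 & C3).
  destruct (locally_2d_open _ u v (locally_2d_and _ _ u v HF (open_locally_2d Dom u v HU Hp)))
    as (U & OU & Up & PU).
  assert (UD : forall a b, U (a, b) -> Dom (a, b)) by (intros a b Hab; apply (PU a b Hab)).
  assert (SxU : vsmooth_on U x) by (intros a b Hab; apply (Sx a b (UD a b Hab))).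
  assert (S1 : tfield_smooth_on U X1) by (split; intros a b Hab; apply (PU a b Hab)).
  assert (S2 : tfield_smooth_on U X2) by (split; intros a b Hab; apply (PU a b Hab)).
  unfold mean_curvature, second_form in HM.
  rewrite !(nor_vdir_push Dom U) in HM by assumption.
  rewrite C2, C3 in HM.
  set (nuu := nor_part x u v (vd_u (vd_u x) u v)) in *.
  set (nvv := nor_part x u v (vd_v (vd_v x) u v)) in *.
  set (nuv := nor_part x u v (vd_u (vd_v x) u v)) in *.
  destruct (Hi u v Hp) as (I1 & I2 & I3).
  set (p := fst X1 u v) in *; set (q := snd X1 u v) in *.
  (* With the coefficients (p, q) and t (q, p) of the frame, the mean curvature is
     (p^2 - q^2) (nvv - nuu) / 2, and p^2 - q^2 = - 1 / E; this is checked in each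
     coordinate g. *)
  assert (N : nvv = nuu).
  { assert (K : forall g : vec4 R -> R,
      (forall k a, g (vscal k a) = k * g a) -> (forall a b, g (vadd a b) = g a + g b) ->
      (forall a b, g (vsub a b) = g a - g b) -> g vzero = 0 -> g nvv = g nuu).
    { intros g G1 G2 G3 G4.
      assert (HG := f_equal g HM); rewrite G4, G1, G3, !G2, !G1 in HG.
      apply (Rmult_eq_reg_l (p ^ 2 - q ^ 2)); [|intro Z; rewrite Z in C1; lra].
      replace (t * q * (t * q)) with (t * t * (q * q)) in HG by ring.
      replace (t * p * (t * p)) with (t * t * (p * p)) in HG by ring.
      replace (t * q * (t * p) + t * p * (t * q)) with (t * t * (2 * p * q)) in HG by ring.
      rewrite Ht in HG; lra. }
    apply vec4_ext; apply K; reflexivity || (intros; reflexivity). }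
  assert (T : vsub (vd_v (vd_v x) u v) (vd_u (vd_u x) u v) = vzero).
  { replace (vsub (vd_v (vd_v x) u v) (vd_u (vd_u x) u v))
      with (vadd (vsub nvv nuu)
        (vsub (tan_part x u v (vd_v (vd_v x) u v)) (tan_part x u v (vd_u (vd_u x) u v))))
      by (unfold nvv, nuu, nor_part; vec; ring).
    rewrite N, !(tan_part_isothermal Dom) by assumption.
    rewrite D1, D3. replace (dot (vd_v (vd_v x) u v) (vd_u x u v)) with (- dot (vd_u (vd_v x) u v) (vd_v x u v)) by lra.
    replace (dot (vd_v (vd_v x) u v) (vd_v x u v)) with (- dot (vd_u (vd_v x) u v) (vd_u x u v)) by lra.
    vec; ring. }
  exact (vsub_eq_vzero _ _ T).
Qed.

(** * The Gauss curvature in terms of the null derivatives *)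

Definition dots4 (a : vec4 R) (p q r s : vec4 R) : vec4 R :=
  Vec4 (dot a p) (dot a q) (dot a r) (dot a s).

(** The metric of R^4_2 has determinant 1, so the product of two determinants
is the determinant of the mixed scalar products, without a sign. *)
Lemma det4_mul_det4 (a b c d p q r s : vec4 R) :
  det4 a b c d * det4 p q r s
  = det4 (dots4 a p q r s) (dots4 b p q r s) (dots4 c p q r s) (dots4 d p q r s).
Proof.
  destruct a, b, c, d, p, q, r, s.
  cbv [dots4 det4 det3 dot Defs.c1 Defs.c2 Defs.c3 Defs.c4].
  ring.
Qed.

(** With [null_minus], the components of Phi = x_u + j x_v along the two
idempotents (1 + j)/2 and (1 - j)/2 of the double numbers. *)
Definition null_plus (x : vfun) : vfun := fun u v => vadd (vd_u x u v) (vd_v x u v).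
Definition null_minus (x : vfun) : vfun := fun u v => vsub (vd_u x u v) (vd_v x u v).

(** By the wave equation the u-derivative of [null_plus x] is also its
v-derivative, hence the component of Phi' along (1 + j)/2. *)
Definition null_plus' (x : vfun) : vfun := vd_u (null_plus x).
Definition null_minus' (x : vfun) : vfun := vd_u (null_minus x).

(** The scalar product of the bivectors a^a' and b^b'. *)
Definition gram2 (a a' b b' : vec4 R) : R := dot a b * dot a' b' - dot a b' * dot a' b.

(** What remains of minimality once the mean curvature has been rewritten as a
differential equation. *)
Definition isothermal_wave (Dom : R * R -> Prop) (x : vfun) : Prop :=
  open Dom /\ vsmooth_on Dom x /\ isothermal Dom x /\
  forall u v, Dom (u, v) -> vd_v (vd_v x) u v = vd_u (vd_u x) u v.

Definition gauss_curvature_expr (x : vfun) (u v : R) : R :=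
  - gram2 (null_plus x u v) (null_plus' x u v) (null_minus x u v) (null_minus' x u v) / (2 * EE x u v ^ 3).
Definition normal_curvature_expr (x : vfun) (u v : R) : R :=
  - det4 (null_plus x u v) (null_minus x u v) (null_plus' x u v) (null_minus' x u v) / (2 * EE x u v ^ 3).

Lemma null_derivatives (Dom : R * R -> Prop) (x : vfun) (u v : R) :
  isothermal_wave Dom x -> Dom (u, v) ->
  null_plus' x u v = vadd (vd_u (vd_u x) u v) (vd_u (vd_v x) u v) /\
  null_minus' x u v = vsub (vd_u (vd_u x) u v) (vd_u (vd_v x) u v).
Proof.
  intros (HU & Sx & _ & _) Hp.
  assert (Su := vsmooth_on_vd_u Dom x Sx); assert (Sv := vsmooth_on_vd_v Dom x Sx).
  split; [apply (vd_u_vadd Dom) | apply (vd_u_vsub Dom)]; auto.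
Qed.

Lemma wave_second_derivatives (Dom : R * R -> Prop) (x : vfun) (u v : R) :
  isothermal_wave Dom x -> Dom (u, v) ->
  dot (vd_u (vd_v x) u v) (vd_v x u v) = - dot (vd_u (vd_u x) u v) (vd_u x u v) /\
  dot (vd_u (vd_v x) u v) (vd_u x u v) = - dot (vd_u (vd_u x) u v) (vd_v x u v).
Proof.
  intros (HU & Sx & Hi & Hw) Hp.
  destruct (isothermal_second_derivatives Dom x u v HU Sx Hi Hp) as (D1 & D2 & D3 & D4).
  rewrite (Hw u v Hp) in D2, D4; lra.
Qed.

(** The Gauss equation gives - (s.s - m.m) / E^2 with s, m the normal parts of
x_uu, x_uv, whatever the frame; s.s - m.m is the product of the normal parts
of a' and b', that is M / (2 E). *)
Lemma gauss_value (Dom : R * R -> Prop) (x : vfun) (X1 X2 : tfield) (u v : R) :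
  isothermal_wave Dom x -> Dom (u, v) -> tangent_frame_near x X1 X2 u v ->
  - dot (curvature_tensor (nabla_LC x) X1 X2 (push x X2) u v) (push x X1 u v)
  = gauss_curvature_expr x u v.
Proof.
  intros HW Hp HF; assert (HW' := HW); destruct HW' as (HU & Sx & Hi & Hw).
  destruct (tangent_frame_coefficients Dom x X1 X2 u v Hi Hp HF) as (C1 & t & Ht & C2 & C3).
  destruct (locally_2d_open _ u v (locally_2d_and _ _ u v HF (open_locally_2d Dom u v HU Hp)))
    as (U & OU & Up & PU).
  assert (UD : forall a b, U (a, b) -> Dom (a, b)) by (intros a b Hab; apply (PU a b Hab)).
  assert (SxU : vsmooth_on U x) by (intros a b Hab; apply (Sx a b (UD a b Hab))).
  assert (S1 : tfield_smooth_on U X1) by (split; intros a b Hab; apply (PU a b Hab)).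
  assert (S2 : tfield_smooth_on U X2) by (split; intros a b Hab; apply (PU a b Hab)).
  change (nabla_LC x) with (fun X Z a b => tan_part x a b (vdir X Z a b)).
  rewrite (curvature_of_projection U (tan_part x) (nor_part x)); auto.
  2:{ intros; unfold nor_part; vec; ring. }
  2:{ intros a b w Hab; destruct (dot_nor_part_tangent Dom x a b w Hi (UD a b Hab)) as (T1 & T2).
      unfold push; dots; rewrite T1, T2; ring. }
  2:{ intros w Sw; now apply (vsmooth_on_nor_part Dom U). }
  2:{ now apply (vsmooth_on_vdir U). }
  2:{ now apply (vsmooth_on_vdir U). }
  rewrite !(nor_vdir_push Dom U) by auto.
  change (push x X1) with (vdir X1 x); change (push x X2) with (vdir X2 x).
  rewrite !(vdir_vdir U) by auto; unfold vdir.
  rewrite !(vd_v_vd_u U x), !Hw by auto; dots.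
  rewrite !(proj1 (dot_nor_part_tangent Dom x u v _ Hi Hp)),
          !(proj2 (dot_nor_part_tangent Dom x u v _ Hi Hp)).
  rewrite !(dot_nor_part Dom) by assumption.
  unfold gauss_curvature_expr, null_plus, null_minus.
  destruct (null_derivatives Dom x u v HW Hp) as (-> & ->).
  destruct (wave_second_derivatives Dom x u v HW Hp) as (D1 & D2).
  destruct (Hi u v Hp) as (I1 & I2 & I3).
  assert (G : dot (vd_v x u v) (vd_v x u v) = - EE x u v) by (unfold GG in I1; lra).
  assert (F1 : dot (vd_u x u v) (vd_v x u v) = 0) by exact I2.
  assert (F2 : dot (vd_v x u v) (vd_u x u v) = 0) by (rewrite dot_sym; exact I2).
  assert (E1 : dot (vd_u x u v) (vd_u x u v) = EE x u v) by reflexivity.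
  unfold gram2; dots.
  rewrite ?(dot_sym (vd_u x u v) (vd_u (vd_u x) u v)), ?(dot_sym (vd_u x u v) (vd_u (vd_v x) u v)),
    ?(dot_sym (vd_v x u v) (vd_u (vd_u x) u v)), ?(dot_sym (vd_v x u v) (vd_u (vd_v x) u v)),
    ?(dot_sym (vd_u (vd_v x) u v) (vd_u (vd_u x) u v)).
  rewrite G, F1, F2, E1, D1, D2, C2, C3.
  set (E := EE x u v) in *; set (p := fst X1 u v) in *; set (q := snd X1 u v) in *.
  set (g := dot (vd_u (vd_u x) u v) (vd_u x u v)).
  set (h := dot (vd_u (vd_u x) u v) (vd_v x u v)).
  set (A := dot (vd_u (vd_u x) u v) (vd_u (vd_u x) u v)).
  set (B := dot (vd_u (vd_v x) u v) (vd_u (vd_v x) u v)).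
  set (C := dot (vd_u (vd_u x) u v) (vd_u (vd_v x) u v)).
  clearbody E p q g h A B C.
  match goal with |- ?L = ?R =>
    transitivity (- (t * t) * (p ^ 2 - q ^ 2) ^ 2 * (A - B - 2 * (g * g - h * h) / E));
    [field; lra|] end.
  rewrite Ht.
  replace (p ^ 2 - q ^ 2) with (- / E)
    by (apply (Rmult_eq_reg_l E); [|lra]; rewrite C1; field; lra).
  field; lra.
Qed.

(** * The curvature of the normal connection *)

Lemma dot_vdir_normal (U : R * R -> Prop) (X : tfield) (n w : vfun) (u v : R) :
  open U -> vsmooth_on U n -> vsmooth_on U w -> U (u, v) ->
  (forall a b, U (a, b) -> dot (n a b) (w a b) = 0) ->
  dot (vdir X n u v) (w u v) = - dot (n u v) (vdir X w u v).
Proof.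
  intros HU Sn Sw Hp H0.
  assert (D := dir_dot U X n w u v HU Sn Sw Hp); unfold dir in D.
  rewrite (d_u_ext U _ (fun _ _ => 0)), (d_v_ext U _ (fun _ _ => 0)), d_u_const, d_v_const
    in D by auto.
  lra.
Qed.

Lemma det4_tangent_pair (a b c d : R) (p q r s : vec4 R) :
  det4 (vadd (vscal a p) (vscal b q)) (vadd (vscal c p) (vscal d q)) r s
  = (a * d - b * c) * det4 p q r s.
Proof.
  unfold det4, det3, vadd, vscal, vmap, vmap2; cbn [c1 c2 c3 c4]; ring.
Qed.

(** The pair (n1, n2) enters the Ricci equation through a 2 x 2 minor of the
normal parts of p and q.  Multiplying by the determinant of the frame, whose
square is E^2 and whose sign is fixed by the orientation, replaces this minor
by a determinant free of n1 and n2. *)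
Lemma adapted_frame_det (E t : R) (xu xv p q n1 n2 : vec4 R) :
  E < 0 -> t * t = 1 ->
  dot xu xu = E -> dot xv xv = - E -> dot xu xv = 0 ->
  dot n1 xu = 0 -> dot n1 xv = 0 -> dot n2 xu = 0 -> dot n2 xv = 0 ->
  dot n1 n1 = -1 -> dot n2 n2 = 1 -> dot n1 n2 = 0 ->
  0 < - t / E * det4 xu xv n1 n2 ->
  det4 xu xv p q = t * E * (dot n1 p * dot n2 q - dot n2 p * dot n1 q).
Proof.
  intros HE Ht E1 E2 E3 N1 N2 N3 N4 N5 N6 N7 Ho.
  assert (D0 := det4_mul_det4 xu xv n1 n2 xu xv n1 n2).
  assert (D1 := det4_mul_det4 xu xv p q xu xv n1 n2).
  unfold dots4 in D0, D1.
  rewrite ?(dot_sym xv xu), ?(dot_sym xu n1), ?(dot_sym xu n2), ?(dot_sym xv n1),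
    ?(dot_sym xv n2), ?(dot_sym n2 n1), E1, E2, E3, N1, N2, N3, N4, N5, N6, N7 in D0.
  rewrite ?(dot_sym xv xu), ?(dot_sym xu n1), ?(dot_sym xu n2), ?(dot_sym xv n1),
    ?(dot_sym xv n2), ?(dot_sym p n1), ?(dot_sym p n2), ?(dot_sym q n1), ?(dot_sym q n2),
    E1, E2, E3, N1, N2, N3, N4 in D1.
  set (d0 := det4 xu xv n1 n2) in *; set (d1 := det4 xu xv p q) in *.
  unfold det4, det3 in D0, D1; cbn [c1 c2 c3 c4] in D0, D1.
  ring_simplify in D0.
  (* The square of d0 is E^2 and t d0 is positive by orientation. *)
  assert (T : t * d0 = - E).
  { assert (P : 0 < t * d0).
    { replace (t * d0) with (- E * (- t / E * d0)) by (field; lra).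
      apply Rmult_lt_0_compat; lra. }
    assert (S : (t * d0) ^ 2 = E ^ 2).
    { replace ((t * d0) ^ 2) with (t * t * d0 ^ 2) by ring; rewrite Ht, D0. ring. }
    nra. }
  apply (Rmult_eq_reg_r (t * d0)); [|lra].
  replace (d1 * (t * d0)) with (t * (d1 * d0)) by ring; rewrite D1, T; ring.
Qed.

(** The Ricci equation: differentiating n.x_u = n.x_v = 0 expresses the
tangential parts of D n1 and D n2 through the second derivatives of x, and
[adapted_frame_det] removes the normal frame. *)
Lemma normal_value (Dom : R * R -> Prop) (x : vfun) (X1 X2 : tfield) (n1 n2 : vfun) (u v : R) :
  isothermal_wave Dom x -> Dom (u, v) ->
  tangent_frame_near x X1 X2 u v -> normal_frame_near x n1 n2 u v ->
  right_oriented_near x X1 X2 n1 n2 u v ->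
  dot (curvature_tensor (nabla_N x) X1 X2 n2 u v) (n1 u v) = normal_curvature_expr x u v.
Proof.
  intros HW Hp HF HN HO; assert (HW' := HW); destruct HW' as (HU & Sx & Hi & Hw).
  destruct (tangent_frame_coefficients Dom x X1 X2 u v Hi Hp HF) as (C1 & t & Ht & C2 & C3).
  assert (Ho := locally_2d_singleton _ _ _ HO).
  destruct (locally_2d_open _ u v (locally_2d_and _ _ u v (locally_2d_and _ _ u v HF HN)
    (open_locally_2d Dom u v HU Hp))) as (U & OU & Up & PU).
  assert (UD : forall a b, U (a, b) -> Dom (a, b)) by (intros a b Hab; apply (PU a b Hab)).
  assert (SxU : vsmooth_on U x) by (intros a b Hab; apply (Sx a b (UD a b Hab))).
  assert (Su := vsmooth_on_vd_u U x SxU); assert (Sv := vsmooth_on_vd_v U x SxU).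
  assert (S1 : tfield_smooth_on U X1) by (split; intros a b Hab; apply (PU a b Hab)).
  assert (S2 : tfield_smooth_on U X2) by (split; intros a b Hab; apply (PU a b Hab)).
  assert (T1 : vsmooth_on U n1) by (intros a b Hab; apply (PU a b Hab)).
  assert (T2 : vsmooth_on U n2) by (intros a b Hab; apply (PU a b Hab)).
  assert (N1 : forall a b, U (a, b) -> dot (n1 a b) (vd_u x a b) = 0)
    by (intros a b Hab; apply (PU a b Hab)).
  assert (N2 : forall a b, U (a, b) -> dot (n1 a b) (vd_v x a b) = 0)
    by (intros a b Hab; apply (PU a b Hab)).
  assert (N3 : forall a b, U (a, b) -> dot (n2 a b) (vd_u x a b) = 0)
    by (intros a b Hab; apply (PU a b Hab)).
  assert (N4 : forall a b, U (a, b) -> dot (n2 a b) (vd_v x a b) = 0)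
    by (intros a b Hab; apply (PU a b Hab)).
  destruct (PU u v Up) as ((_ & _ & _ & N5 & N6 & N7) & _).
  change (nabla_N x) with (fun X Z a b => nor_part x a b (vdir X Z a b)).
  rewrite (curvature_of_projection U (nor_part x) (tan_part x)); auto.
  2:{ intros a b w Hab; rewrite (tan_part_isothermal Dom) by auto; dots.
      rewrite (dot_sym (vd_u x a b)), (dot_sym (vd_v x a b)), N1, N2 by auto; ring. }
  2:{ intros w Sw; now apply (vsmooth_on_tan_part Dom U). }
  rewrite !(tan_part_isothermal Dom) by auto; dots.
  rewrite !(dot_sym (vd_u x u v) (vdir _ _ u v)), !(dot_sym (vd_v x u v) (vdir _ _ u v)).
  rewrite !(dot_vdir_normal U _ _ (vd_u x)), !(dot_vdir_normal U _ _ (vd_v x)) by auto.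
  unfold vdir; rewrite !(vd_v_vd_u U x), !Hw by auto; dots.
  destruct (Hi u v Hp) as (I1 & I2 & I3).
  assert (G : dot (vd_v x u v) (vd_v x u v) = - EE x u v) by (unfold GG in I1; lra).
  assert (Q : fst X1 u v ^ 2 - snd X1 u v ^ 2 = - / EE x u v)
    by (apply (Rmult_eq_reg_l (EE x u v)); [|lra]; rewrite C1; field; lra).
  unfold push in Ho; rewrite det4_tangent_pair, C2, C3 in Ho.
  assert (A := adapted_frame_det (EE x u v) t (vd_u x u v) (vd_v x u v)
    (vd_u (vd_u x) u v) (vd_u (vd_v x) u v) (n1 u v) (n2 u v) I3 Ht eq_refl G I2
    (N1 u v Up) (N2 u v Up) (N3 u v Up) (N4 u v Up) N5 N6 N7).
  assert (Ho' : 0 < - t / EE x u v * det4 (vd_u x u v) (vd_v x u v) (n1 u v) (n2 u v)).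
  { replace (- t / EE x u v) with (fst X1 u v * (t * fst X1 u v) - snd X1 u v * (t * snd X1 u v)).
    - exact Ho.
    - unfold Rdiv; rewrite <- Ropp_mult_distr_l, Ropp_mult_distr_r, <- Q; ring. }
  specialize (A Ho').
  unfold normal_curvature_expr.
  destruct (null_derivatives Dom x u v HW Hp) as (-> & ->).
  replace (det4 (null_plus x u v) (null_minus x u v)
    (vadd (vd_u (vd_u x) u v) (vd_u (vd_v x) u v)) (vsub (vd_u (vd_u x) u v) (vd_u (vd_v x) u v)))
    with (4 * det4 (vd_u x u v) (vd_v x u v) (vd_u (vd_u x) u v) (vd_u (vd_v x) u v))
    by (unfold null_plus, null_minus, det4, det3, vadd, vsub, vmap2; cbn [c1 c2 c3 c4]; ring).
  rewrite A, C2, C3.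
  set (E := EE x u v) in *; set (p := fst X1 u v) in *; set (q := snd X1 u v) in *.
  match goal with |- ?L = ?R =>
    transitivity (2 * t * (p ^ 2 - q ^ 2) / E *
      (dot (n1 u v) (vd_u (vd_u x) u v) * dot (n2 u v) (vd_u (vd_v x) u v)
       - dot (n2 u v) (vd_u (vd_u x) u v) * dot (n1 u v) (vd_u (vd_v x) u v)));
    [field; lra|] end.
  rewrite Q; field; lra.
Qed.

(** * Liouville equations from the splitting of bivectors *)

Lemma is_derive_ln_abs (y : R) : y <> 0 -> is_derive (fun t => ln (Rabs t)) y (/ y).
Proof.
  intros Hy; replace (/ y) with (sign y * 1 * / Rabs y).
  - apply (is_derive_comp ln Rabs).
    + apply is_derive_ln, Rabs_pos_lt, Hy.
    + apply (is_derive_Rabs (fun t => t)); auto; apply (is_derive_id (K := R_AbsRing)).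
  - destruct (Rtotal_order y 0) as [H|[H|H]]; [|lra|].
    + rewrite sign_eq_m1, Rabs_left by assumption; field; lra.
    + rewrite sign_eq_1, Rabs_right by lra; field; lra.
Qed.

Lemma ln_abs_slices (U : R * R -> Prop) (f : R -> R -> R) (u v : R) :
  smooth_on U f -> U (u, v) -> f u v <> 0 ->
  is_derive (fun s => ln (Rabs (f s v))) u (d_u f u v / f u v) /\
  is_derive (fun s => ln (Rabs (f u s))) v (d_v f u v / f u v).
Proof.
  intros Sf Hp Hn; destruct (ex_derive_slices f u v (Sf u v Hp)) as (H1 & H2).
  split.
  - apply (is_derive_comp (fun t => ln (Rabs t)) (fun s => f s v));
      [now apply is_derive_ln_abs | apply (Derive_correct (fun s => f s v) u H1)].
  - apply (is_derive_comp (fun t => ln (Rabs t)) (fun s => f u s));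
      [now apply is_derive_ln_abs | apply (Derive_correct (fun s => f u s) v H2)].
Qed.

Lemma smooth_on_ln_abs (U : R * R -> Prop) (f : R -> R -> R) :
  open U -> smooth_on U f -> (forall u v, U (u, v) -> f u v <> 0) ->
  smooth_on U (fun a b => ln (Rabs (f a b))).
Proof.
  intros HU Sf Hn.
  apply (smooth_on_intro U _ (fun a b => d_u f a b / f a b) (fun a b => d_v f a b / f a b));
    auto; try (apply smooth_on_div; auto using smooth_on_d_u, smooth_on_d_v).
  intros u v Hp; split; [|apply (ln_abs_slices U f); auto].
  apply (continuity_1d_2d_pt_comp (fun t => ln (Rabs t)) f).
  - apply continuity_pt_filterlim.
    apply (ex_derive_continuous (K := R_AbsRing) (V := R_NormedModule) (fun t => ln (Rabs t))).
    exists (/ f u v); now apply is_derive_ln_abs, Hn.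
  - apply smooth_at_cont, Sf, Hp.
Qed.

Lemma d_u_div (U : R * R -> Prop) (f g : R -> R -> R) (u v : R) :
  smooth_on U f -> smooth_on U g -> U (u, v) -> g u v <> 0 ->
  d_u (fun a b => f a b / g a b) u v
  = (d_u f u v * g u v - f u v * d_u g u v) / g u v ^ 2.
Proof.
  intros Hf Hg Hp Hn.
  exact (Derive_div (fun s => f s v) (fun s => g s v) u
    (proj1 (ex_derive_slices f u v (Hf u v Hp))) (proj1 (ex_derive_slices g u v (Hg u v Hp))) Hn).
Qed.

Lemma d_v_div (U : R * R -> Prop) (f g : R -> R -> R) (u v : R) :
  smooth_on U f -> smooth_on U g -> U (u, v) -> g u v <> 0 ->
  d_v (fun a b => f a b / g a b) u v
  = (d_v f u v * g u v - f u v * d_v g u v) / g u v ^ 2.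
Proof.
  intros Hf Hg Hp Hn.
  exact (Derive_div (fun s => f u s) (fun s => g u s) v
    (proj2 (ex_derive_slices f u v (Hf u v Hp))) (proj2 (ex_derive_slices g u v (Hg u v Hp))) Hn).
Qed.

Lemma hlaplacian_ext (U : R * R -> Prop) (f g : R -> R -> R) (u v : R) :
  open U -> (forall a b, U (a, b) -> f a b = g a b) -> U (u, v) ->
  hlaplacian f u v = hlaplacian g u v.
Proof.
  intros HU E Hp; unfold hlaplacian.
  rewrite (d_u_ext U (d_u f) (d_u g)), (d_v_ext U (d_v f) (d_v g)); auto;
    intros a b Hab; [apply (d_v_ext U) | apply (d_u_ext U)]; auto.
Qed.

Lemma hlaplacian_linear (U : R * R -> Prop) (k l m : R) (f g : R -> R -> R) (u v : R) :
  open U -> smooth_on U f -> smooth_on U g -> U (u, v) ->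
  hlaplacian (fun a b => k + l * f a b + m * g a b) u v
  = l * hlaplacian f u v + m * hlaplacian g u v.
Proof.
  intros HU Sf Sg Hp; unfold hlaplacian.
  rewrite (d_u_ext U _ (fun a b => l * d_u f a b + m * d_u g a b)) by
    (auto; intros a b Hab; deriv U; ring).
  rewrite (d_v_ext U _ (fun a b => l * d_v f a b + m * d_v g a b)) by
    (auto; intros a b Hab; deriv U; ring).
  deriv U.
  change (d_u (fun a b => d_u f a b) u v) with (d_u (d_u f) u v).
  change (d_u (fun a b => d_u g a b) u v) with (d_u (d_u g) u v).
  change (d_v (fun a b => d_v f a b) u v) with (d_v (d_v f) u v).
  change (d_v (fun a b => d_v g a b) u v) with (d_v (d_v g) u v).
  ring.
Qed.

Lemma hlaplacian_ln_abs (U : R * R -> Prop) (f : R -> R -> R) (u v : R) :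
  open U -> smooth_on U f -> (forall a b, U (a, b) -> f a b <> 0) -> U (u, v) ->
  hlaplacian (fun a b => ln (Rabs (f a b))) u v
  = (f u v * hlaplacian f u v - (d_u f u v ^ 2 - d_v f u v ^ 2)) / f u v ^ 2.
Proof.
  intros HU Sf Hn Hp; unfold hlaplacian at 1.
  rewrite (d_u_ext U _ (fun a b => d_u f a b / f a b)); auto.
  2:{ intros a b Hab; apply is_derive_unique, (ln_abs_slices U f a b Sf Hab (Hn a b Hab)). }
  rewrite (d_v_ext U _ (fun a b => d_v f a b / f a b)); auto.
  2:{ intros a b Hab; apply is_derive_unique, (ln_abs_slices U f a b Sf Hab (Hn a b Hab)). }
  rewrite (d_u_div U (d_u f) f), (d_v_div U (d_v f) f) by auto using smooth_on_d_u, smooth_on_d_v.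
  unfold hlaplacian; field; auto.
Qed.

(** If a is a function of u + v and b one of u - v, then Delta^h ln|a.b| is
four times the mixed derivative of ln|a.b| in the variables u + v, u - v,
and the terms with second derivatives of a or of b alone cancel. *)
Lemma hlaplacian_ln_abs_dot (U : R * R -> Prop) (a b : vfun) (u v : R) :
  open U -> vsmooth_on U a -> vsmooth_on U b ->
  (forall s t, U (s, t) -> vd_v a s t = vd_u a s t) ->
  (forall s t, U (s, t) -> vd_v b s t = vscal (-1) (vd_u b s t)) ->
  (forall s t, U (s, t) -> dot (a s t) (b s t) <> 0) -> U (u, v) ->
  hlaplacian (fun s t => ln (Rabs (dot (a s t) (b s t)))) u v
  = 4 * gram2 (a u v) (vd_u a u v) (b u v) (vd_u b u v) / dot (a u v) (b u v) ^ 2.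
Proof.
  intros HU Sa Sb Ha Hb Hn Hp.
  assert (Sa' := vsmooth_on_vd_u U a Sa); assert (Sb' := vsmooth_on_vd_u U b Sb).
  rewrite (hlaplacian_ln_abs U) by auto using smooth_on_dot.
  assert (Ha' : vd_v (vd_u a) u v = vd_u (vd_u a) u v).
  { rewrite (vd_v_vd_u U) by auto; now apply (vd_u_ext U). }
  assert (Hb' : vd_v (vd_u b) u v = vscal (-1) (vd_u (vd_u b) u v)).
  { rewrite (vd_v_vd_u U) by auto; rewrite (vd_u_ext U _ (fun s t => vscal (-1) (vd_u b s t))) by auto.
    rewrite (vd_u_vscal U (fun _ _ => -1)) by auto using smooth_on_const.
    rewrite d_u_const; vec; ring. }
  assert (Eu : forall s t, U (s, t) -> d_u (fun s t => dot (a s t) (b s t)) s t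
    = dot (vd_u a s t) (b s t) + dot (a s t) (vd_u b s t)) by (intros; now apply (d_u_dot U)).
  assert (Ev : forall s t, U (s, t) -> d_v (fun s t => dot (a s t) (b s t)) s t
    = dot (vd_u a s t) (b s t) - dot (a s t) (vd_u b s t)).
  { intros; rewrite (d_v_dot U), Ha, Hb by auto; dots; ring. }
  unfold hlaplacian; rewrite (d_u_ext U _ _ u v HU Eu Hp), (d_v_ext U _ _ u v HU Ev Hp).
  rewrite (d_u_plus U) by auto using smooth_on_dot; rewrite (d_v_minus U) by auto using smooth_on_dot.
  rewrite Eu, Ev by auto.
  rewrite (d_u_dot U (vd_u a) b), (d_u_dot U a (vd_u b)), (d_v_dot U (vd_u a) b), (d_v_dot U a (vd_u b))
    by auto.
  rewrite Ha', Hb', Ha, Hb by auto; dots; unfold gram2; field; auto.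
Qed.

(** The component of the bivector a^b in one of the two ideals of so(2,2)
(self-dual for one sign s, anti-self-dual for the other).  It is
three-dimensional; padding with a zero fourth coordinate makes [dot] its
Lorentzian scalar product, up to a factor. *)
Definition dual_half (s : R) (a b : vec4 R) : vec4 R :=
  let w (i j k l : R) := i * l - j * k in
  Vec4 (w (c1 a) (c2 a) (c1 b) (c2 b) + s * w (c3 a) (c4 a) (c3 b) (c4 b))
       (w (c1 a) (c3 a) (c1 b) (c3 b) + s * w (c2 a) (c4 a) (c2 b) (c4 b))
       (w (c1 a) (c4 a) (c1 b) (c4 b) + s * w (c2 a) (c3 a) (c2 b) (c3 b)) 0.

(** The product of a^a' and b^b' in the metric of bivectors is [gram2], and
their wedge product is a determinant; the halves combine both. *)
Lemma dot_dual_half (s : R) (a a' b b' : vec4 R) :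
  s * s = 1 ->
  dot (dual_half s a a') (dual_half s b b') = gram2 a a' b b' + s * det4 a b a' b'.
Proof.
  intros Hs; unfold dual_half, gram2, det4, det3, dot; cbn [c1 c2 c3 c4].
  ring [Hs].
Qed.

(** The vector product of the Lorentzian 3-space of vectors with zero fourth
coordinate, with components ordered and signed so that [gram2_cross] holds
for [dot]. *)
Definition cross (a b : vec4 R) : vec4 R :=
  Vec4 (c2 a * c3 b - c3 a * c2 b) (c1 a * c3 b - c3 a * c1 b) (c1 a * c2 b - c2 a * c1 b) 0.

Lemma gram2_cross (a a' b b' : vec4 R) :
  c4 a = 0 -> c4 a' = 0 -> gram2 a a' b b' = dot (cross a a') (cross b b').
Proof.
  intros H H'; unfold gram2, cross, dot; cbn [c1 c2 c3 c4]; rewrite H, H'; ring.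
Qed.

(** Passing to a half is, up to the sign s, a Lie algebra morphism: under
vscal s, the right-hand side is the half of the bracket of a^b and a^c. *)
Lemma cross_dual_half (s : R) (a b c : vec4 R) :
  s * s = 1 ->
  cross (dual_half s a b) (dual_half s a c)
  = vscal s (vsub (vsub (vscal (dot a b) (dual_half s a c)) (vscal (dot a a) (dual_half s b c)))
                  (vscal (dot a c) (dual_half s a b))).
Proof.
  intros Hs; unfold cross, dual_half, dot; vec; ring [Hs].
Qed.

(** By [cross_dual_half] the vector product of the halves of a^a' and a^a'' is
s e times the half of a^a', so the Gram determinant, being a product of two
vector products, reproduces the scalar product itself. *)
Lemma gram2_dual_half (s e f : R) (a a' a'' b b' b'' : vec4 R) :
  s * s = 1 ->
  dot a a = 0 -> dot a a' = 0 -> dot a a'' = - e ->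
  dot b b = 0 -> dot b b' = 0 -> dot b b'' = - f ->
  gram2 (dual_half s a a') (dual_half s a a'') (dual_half s b b') (dual_half s b b'')
  = e * f * dot (dual_half s a a') (dual_half s b b').
Proof.
  intros Hs A1 A2 A3 B1 B2 B3.
  rewrite gram2_cross by reflexivity; rewrite !cross_dual_half, A1, A2, A3, B1, B2, B3 by assumption.
  do 3 dots; ring [Hs].
Qed.

Lemma vsmooth_on_dual_half (U : R * R -> Prop) (s : R) (a b : vfun) :
  open U -> vsmooth_on U a -> vsmooth_on U b ->
  vsmooth_on U (fun p q => dual_half s (a p q) (b p q)).
Proof. unfold dual_half; vsmooth. Qed.

Lemma vd_u_dual_half (U : R * R -> Prop) (s : R) (a b : vfun) (u v : R) :
  open U -> vsmooth_on U a -> vsmooth_on U b -> U (u, v) ->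
  vd_u (fun p q => dual_half s (a p q) (b p q)) u v
  = vadd (dual_half s (vd_u a u v) (b u v)) (dual_half s (a u v) (vd_u b u v)).
Proof. intros; unfold dual_half; vderiv U. Qed.

Lemma vd_v_dual_half (U : R * R -> Prop) (s : R) (a b : vfun) (u v : R) :
  open U -> vsmooth_on U a -> vsmooth_on U b -> U (u, v) ->
  vd_v (fun p q => dual_half s (a p q) (b p q)) u v
  = vadd (dual_half s (vd_v a u v) (b u v)) (dual_half s (a u v) (vd_v b u v)).
Proof. intros; unfold dual_half; vderiv U. Qed.

(** * The system for the two curvatures *)

Lemma null_products (Dom : R * R -> Prop) (x : vfun) (u v : R) :
  isothermal_wave Dom x -> Dom (u, v) ->
  dot (null_plus x u v) (null_plus x u v) = 0 /\ dot (null_minus x u v) (null_minus x u v) = 0 /\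
  dot (null_plus x u v) (null_minus x u v) = 2 * EE x u v /\
  dot (null_plus x u v) (null_plus' x u v) = 0 /\ dot (null_minus x u v) (null_minus' x u v) = 0.
Proof.
  intros HW Hp; assert (HW' := HW); destruct HW' as (HU & Sx & Hi & Hw).
  destruct (null_derivatives Dom x u v HW Hp) as (-> & ->).
  destruct (wave_second_derivatives Dom x u v HW Hp) as (D1 & D2).
  destruct (Hi u v Hp) as (I1 & I2 & I3); unfold EE, FF, GG in *.
  unfold null_plus, null_minus; dots.
  rewrite (dot_sym (vd_v x u v) (vd_u x u v)), (dot_sym (vd_u x u v) (vd_u (vd_u x) u v)),
    (dot_sym (vd_u x u v) (vd_u (vd_v x) u v)), (dot_sym (vd_v x u v) (vd_u (vd_u x) u v)),
    (dot_sym (vd_v x u v) (vd_u (vd_v x) u v)).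
  lra.
Qed.

Lemma null_fields_smooth (Dom : R * R -> Prop) (x : vfun) :
  isothermal_wave Dom x ->
  vsmooth_on Dom (null_plus x) /\ vsmooth_on Dom (null_minus x) /\
  vsmooth_on Dom (null_plus' x) /\ vsmooth_on Dom (null_minus' x).
Proof.
  intros (HU & Sx & _).
  assert (Su := vsmooth_on_vd_u Dom x Sx); assert (Sv := vsmooth_on_vd_v Dom x Sx).
  assert (Sa : vsmooth_on Dom (null_plus x)) by now apply vsmooth_on_vadd.
  assert (Sb : vsmooth_on Dom (null_minus x)) by now apply vsmooth_on_vsub.
  split; [|split; [|split]]; auto; now apply vsmooth_on_vd_u.
Qed.

Lemma vd_v_null_plus (Dom : R * R -> Prop) (x : vfun) (u v : R) :
  isothermal_wave Dom x -> Dom (u, v) -> vd_v (null_plus x) u v = null_plus' x u v.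
Proof.
  intros HW Hp; rewrite (proj1 (null_derivatives Dom x u v HW Hp)).
  destruct HW as (HU & Sx & Hi & Hw).
  assert (Su := vsmooth_on_vd_u Dom x Sx); assert (Sv := vsmooth_on_vd_v Dom x Sx).
  unfold null_plus; rewrite (vd_v_vadd Dom (vd_u x) (vd_v x)), (vd_v_vd_u Dom), Hw by auto.
  vec; ring.
Qed.

Lemma vd_v_null_minus (Dom : R * R -> Prop) (x : vfun) (u v : R) :
  isothermal_wave Dom x -> Dom (u, v) -> vd_v (null_minus x) u v = vscal (-1) (null_minus' x u v).
Proof.
  intros HW Hp; rewrite (proj2 (null_derivatives Dom x u v HW Hp)).
  destruct HW as (HU & Sx & Hi & Hw).
  assert (Su := vsmooth_on_vd_u Dom x Sx); assert (Sv := vsmooth_on_vd_v Dom x Sx).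
  unfold null_minus; rewrite (vd_v_vsub Dom (vd_u x) (vd_v x)), (vd_v_vd_u Dom), Hw by auto.
  vec; ring.
Qed.

Lemma vd_v_null_plus' (Dom : R * R -> Prop) (x : vfun) (u v : R) :
  isothermal_wave Dom x -> Dom (u, v) -> vd_v (null_plus' x) u v = vd_u (null_plus' x) u v.
Proof.
  intros HW Hp; destruct (null_fields_smooth Dom x HW) as (Sa & _).
  assert (HU := proj1 HW).
  unfold null_plus' at 1; rewrite (vd_v_vd_u Dom) by auto.
  apply (vd_u_ext Dom); auto; intros; now apply (vd_v_null_plus Dom).
Qed.

Lemma vd_v_null_minus' (Dom : R * R -> Prop) (x : vfun) (u v : R) :
  isothermal_wave Dom x -> Dom (u, v) ->
  vd_v (null_minus' x) u v = vscal (-1) (vd_u (null_minus' x) u v).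
Proof.
  intros HW Hp; destruct (null_fields_smooth Dom x HW) as (_ & Sb & _ & Sb').
  assert (HU := proj1 HW).
  unfold null_minus' at 1; rewrite (vd_v_vd_u Dom) by auto.
  rewrite (vd_u_ext Dom _ (fun s t => vscal (-1) (null_minus' x s t)));
    auto; [|intros; now apply (vd_v_null_minus Dom)].
  rewrite (vd_u_vscal Dom (fun _ _ => -1)) by auto using smooth_on_const.
  rewrite d_u_const; vec; ring.
Qed.

(** The condition that canonical coordinates impose: the null curves with
tangents a and b have second derivatives of constant square. *)
Definition unit_null_derivatives (Dom : R * R -> Prop) (x : vfun) (e f : R) : Prop :=
  isothermal_wave Dom x /\
  forall u v, Dom (u, v) ->
    dot (null_plus' x u v) (null_plus' x u v) = e /\ dot (null_minus' x u v) (null_minus' x u v) = f.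

(** Differentiate a.a' = 0. *)
Lemma dot_second_null_derivative (U : R * R -> Prop) (a a' : vfun) (e : R) (u v : R) :
  open U -> vsmooth_on U a -> vsmooth_on U a' -> U (u, v) ->
  vd_u a u v = a' u v -> dot (a' u v) (a' u v) = e ->
  (forall s t, U (s, t) -> dot (a s t) (a' s t) = 0) ->
  dot (a u v) (vd_u a' u v) = - e.
Proof.
  intros HU Sa Sa' Hp E1 E2 E3.
  assert (D := d_u_dot U a a' u v HU Sa Sa' Hp).
  rewrite (d_u_ext U _ (fun _ _ => 0)), d_u_const, E1, E2 in D by auto; lra.
Qed.

Definition dual_gram (s : R) (x : vfun) (u v : R) : R :=
  dot (dual_half s (null_plus x u v) (null_plus' x u v)) (dual_half s (null_minus x u v) (null_minus' x u v)).

(** Both sides are M^2 - D^2: the square of D is the Gram determinant of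
a, b, a', b', most of whose entries vanish. *)
Lemma dual_gram_product (Dom : R * R -> Prop) (x : vfun) (e f u v : R) :
  unit_null_derivatives Dom x e f -> Dom (u, v) ->
  dual_gram 1 x u v * dual_gram (-1) x u v = 4 * e * f * EE x u v ^ 2.
Proof.
  intros (HW & HN) Hp; destruct (HN u v Hp) as (N1 & N2).
  destruct (null_products Dom x u v HW Hp) as (A1 & B1 & AB & A2 & B2).
  unfold dual_gram; rewrite !dot_dual_half by ring.
  set (a := null_plus x u v) in *; set (b := null_minus x u v) in *;
  set (a' := null_plus' x u v) in *; set (b' := null_minus' x u v) in *.
  assert (D := det4_mul_det4 a b a' b' a b a' b').
  unfold dots4 in D.
  rewrite (dot_sym b a), (dot_sym a' a), (dot_sym b' a), (dot_sym a' b), (dot_sym b' b),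
    (dot_sym b' a'), A1, B1, AB, A2, B2, N1, N2 in D.
  unfold gram2; rewrite (dot_sym a' b), AB.
  replace ((2 * EE x u v * dot a' b' - dot a b' * dot b a' + 1 * det4 a b a' b') *
    (2 * EE x u v * dot a' b' - dot a b' * dot b a' + -1 * det4 a b a' b'))
    with ((2 * EE x u v * dot a' b' - dot a b' * dot b a') ^ 2 - det4 a b a' b' * det4 a b a' b')
    by ring.
  rewrite D; unfold det4, det3; cbn [c1 c2 c3 c4]; ring.
Qed.

(** [hlaplacian_ln_abs_dot] applies to the halves of a^a' and b^b'; their
derivatives are the halves of a^a'' and b^b'', and [gram2_dual_half] evaluates
the resulting Gram determinant. *)
Lemma dual_gram_liouville (Dom : R * R -> Prop) (x : vfun) (s e f u v : R) :
  s * s = 1 -> unit_null_derivatives Dom x e f ->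
  (forall a b, Dom (a, b) -> dual_gram s x a b <> 0) -> Dom (u, v) ->
  hlaplacian (fun a b => ln (Rabs (dual_gram s x a b))) u v = 4 * e * f / dual_gram s x u v.
Proof.
  intros Hs (HW & HN) Hn Hp; assert (HU := proj1 HW).
  destruct (null_fields_smooth Dom x HW) as (Sa & Sb & Sa' & Sb').
  unfold dual_gram.
  rewrite (hlaplacian_ln_abs_dot Dom (fun p q => dual_half s (null_plus x p q) (null_plus' x p q))
    (fun p q => dual_half s (null_minus x p q) (null_minus' x p q))); auto using vsmooth_on_dual_half.
  2:{ intros p q Hpq; rewrite (vd_v_dual_half Dom), (vd_u_dual_half Dom) by auto.
      now rewrite (vd_v_null_plus Dom), (vd_v_null_plus' Dom). }
  2:{ intros p q Hpq; rewrite (vd_v_dual_half Dom), (vd_u_dual_half Dom) by auto.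
      rewrite (vd_v_null_minus Dom), (vd_v_null_minus' Dom) by auto.
      change (vd_u (null_minus x) p q) with (null_minus' x p q).
      unfold dual_half; vec; ring. }
  rewrite !(vd_u_dual_half Dom) by auto.
  change (vd_u (null_plus x) u v) with (null_plus' x u v); change (vd_u (null_minus x) u v) with (null_minus' x u v).
  (* In the derivative of a^a' the term a'^a' vanishes. *)
  assert (Z : forall a b : vec4 R, vadd (dual_half s a a) b = b).
  { intros a b; destruct b; unfold dual_half, vadd, vmap2; cbn [Defs.c1 Defs.c2 Defs.c3 Defs.c4].
    f_equal; ring. }
  rewrite !Z.
  destruct (null_products Dom x u v HW Hp) as (A1 & B1 & _ & A2 & B2).
  destruct (HN u v Hp) as (N1 & N2).
  rewrite (gram2_dual_half s e f); auto.
  - assert (N := Hn u v Hp); unfold dual_gram in N; field; exact N.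
  - apply (dot_second_null_derivative Dom); auto.
    intros p q Hpq; apply (null_products Dom x p q HW Hpq).
  - apply (dot_second_null_derivative Dom); auto.
    intros p q Hpq; apply (null_products Dom x p q HW Hpq).
Qed.

Lemma smooth_curvature_exprs (Dom : R * R -> Prop) (x : vfun) :
  isothermal_wave Dom x ->
  smooth_on Dom (gauss_curvature_expr x) /\ smooth_on Dom (normal_curvature_expr x).
Proof.
  intros HW; destruct (null_fields_smooth Dom x HW) as (Sa & Sb & Sa' & Sb').
  destruct HW as (HU & Sx & Hi & _).
  assert (SE : smooth_on Dom (EE x)) by (apply smooth_on_dot; auto using vsmooth_on_vd_u).
  assert (S3 : smooth_on Dom (fun a b => 2 * EE x a b ^ 3)).
  { apply (smooth_on_ext Dom (fun a b => 2 * (EE x a b * (EE x a b * EE x a b)))); auto.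
    - intros; ring.
    - repeat first [apply smooth_on_mult | apply smooth_on_const]; auto. }
  assert (N3 : forall a b, Dom (a, b) -> 2 * EE x a b ^ 3 <> 0).
  { intros a b Hab; destruct (Hi a b Hab) as (_ & _ & H).
    apply Rmult_integral_contrapositive_currified; [lra|]; apply pow_nonzero; lra. }
  split.
  - unfold gauss_curvature_expr; apply smooth_on_div; auto; apply smooth_on_opp; auto.
    unfold gram2; apply smooth_on_minus; auto; apply smooth_on_mult; auto; now apply smooth_on_dot.
  - unfold normal_curvature_expr; apply smooth_on_div; auto; apply smooth_on_opp; auto.
    unfold det4, det3; repeat smooth_step.
Qed.

Lemma smooth_on_dual_gram (Dom : R * R -> Prop) (x : vfun) (s : R) :
  isothermal_wave Dom x -> smooth_on Dom (dual_gram s x).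
Proof.
  intros HW; destruct (null_fields_smooth Dom x HW) as (Sa & Sb & Sa' & Sb').
  destruct HW as (HU & _); apply smooth_on_dot; auto; now apply vsmooth_on_dual_half.
Qed.

(** K + kappa and K - kappa are, up to the factor - 1 / (2 E^3), the two
solutions M + D and M - D of Liouville's equations, whose product is
4 e f E^2.  This expresses E, and with it the fourth root, through them. *)
Lemma system_of_unit_null_derivatives (Dom : R * R -> Prop) (x : vfun) (e f : R) (K kappa : R -> R -> R) :
  unit_null_derivatives Dom x e f -> e * e = 1 -> f * f = 1 ->
  (forall u v, Dom (u, v) -> K u v = gauss_curvature_expr x u v) ->
  (forall u v, Dom (u, v) -> kappa u v = normal_curvature_expr x u v) ->
  solves_system Dom K kappa.
Proof.
  intros HN He Hf HK Hk; assert (HW := proj1 HN); assert (HU := proj1 HW).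
  assert (HE : forall u v, Dom (u, v) -> EE x u v < 0)
    by (intros u v Hp; apply (proj1 (proj2 (proj2 HW)) u v Hp)).
  destruct (smooth_curvature_exprs Dom x HW) as (SK & Sk).
  assert (P := fun u v => dual_gram_product Dom x e f u v HN).
  assert (Ef2 : e * f * (e * f) = 1)
    by (replace (e * f * (e * f)) with (e * e * (f * f)) by ring; rewrite He, Hf; ring).
  assert (Nef : e * f <> 0) by (intro Z; rewrite Z in Ef2; lra).
  assert (N0 : forall u v, Dom (u, v) -> dual_gram 1 x u v * dual_gram (-1) x u v <> 0).
  { intros u v Hp; rewrite P by assumption.
    replace (4 * e * f * EE x u v ^ 2) with (4 * (e * f) * EE x u v ^ 2) by ring.
    assert (HEp := HE u v Hp).
    apply Rmult_integral_contrapositive_currified; [|apply pow_nonzero; lra].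
    apply Rmult_integral_contrapositive_currified; [lra | exact Nef]. }
  assert (N1 : forall u v, Dom (u, v) -> dual_gram 1 x u v <> 0)
    by (intros u v Hp Z; apply (N0 u v Hp); rewrite Z; ring).
  assert (N2 : forall u v, Dom (u, v) -> dual_gram (-1) x u v <> 0)
    by (intros u v Hp Z; apply (N0 u v Hp); rewrite Z; ring).
  assert (L1 := fun u v => dual_gram_liouville Dom x 1 e f u v ltac:(ring) HN N1).
  assert (L2 := fun u v => dual_gram_liouville Dom x (-1) e f u v ltac:(ring) HN N2).
  assert (S1 := smooth_on_dual_gram Dom x 1 HW); assert (S2 := smooth_on_dual_gram Dom x (-1) HW).
  assert (T1 := smooth_on_ln_abs Dom _ HU S1 N1); assert (T2 := smooth_on_ln_abs Dom _ HU S2 N2).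
  assert (KP : forall u v, Dom (u, v) -> K u v + kappa u v = - dual_gram 1 x u v / (2 * EE x u v ^ 3)).
  { intros u v Hp; rewrite HK, Hk by assumption; unfold gauss_curvature_expr, normal_curvature_expr, dual_gram.
    rewrite dot_dual_half by ring; assert (HEp := HE u v Hp); field; lra. }
  assert (KM : forall u v, Dom (u, v) -> K u v - kappa u v = - dual_gram (-1) x u v / (2 * EE x u v ^ 3)).
  { intros u v Hp; rewrite HK, Hk by assumption; unfold gauss_curvature_expr, normal_curvature_expr, dual_gram.
    rewrite dot_dual_half by ring; assert (HEp := HE u v Hp); field; lra. }
  assert (Q : forall u v, Dom (u, v) -> K u v ^ 2 - kappa u v ^ 2 = e * f / EE x u v ^ 4).
  { intros u v Hp; assert (HEp := HE u v Hp).
    replace (K u v ^ 2 - kappa u v ^ 2) with ((K u v + kappa u v) * (K u v - kappa u v)) by ring.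
    rewrite KP, KM by assumption.
    transitivity (dual_gram 1 x u v * dual_gram (-1) x u v / (4 * EE x u v ^ 6)); [field; lra|].
    rewrite P by assumption; field; lra. }
  assert (Ef : Rabs (e * f) = 1).
  { assert (Rabs (e * f) * Rabs (e * f) = 1).
    { rewrite <- Rabs_mult, Ef2; apply Rabs_R1. }
    assert (0 <= Rabs (e * f)) by apply Rabs_pos; nra. }
  assert (AQ : forall u v, Dom (u, v) -> Rabs (K u v ^ 2 - kappa u v ^ 2) = / EE x u v ^ 4).
  { intros u v Hp; assert (HEp := HE u v Hp); rewrite Q by assumption.
    unfold Rdiv; rewrite Rabs_mult, Ef, Rmult_1_l; apply Rabs_right.
    apply Rle_ge, Rlt_le, Rinv_0_lt_compat.
    replace (EE x u v ^ 4) with ((EE x u v * EE x u v) * (EE x u v * EE x u v)) by ring.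
    assert (0 < EE x u v * EE x u v) by nra; nra. }
  split; [|split].
  { apply (smooth_on_ext Dom (gauss_curvature_expr x)); auto; intros; symmetry; auto. }
  { apply (smooth_on_ext Dom (normal_curvature_expr x)); auto; intros; symmetry; auto. }
  intros u v Hp; assert (HEp := HE u v Hp); cbv beta zeta.
  (* E is negative, so the fourth root of 1 / E^4 is - 1 / E. *)
  assert (R4 : sqrt (sqrt (Rabs (K u v ^ 2 - kappa u v ^ 2))) = - / EE x u v).
  { assert (I : 0 < - / EE x u v) by (apply Ropp_0_gt_lt_contravar, Rinv_lt_0_compat, HEp).
    rewrite AQ by assumption.
    replace (/ EE x u v ^ 4) with ((- / EE x u v * - / EE x u v) * (- / EE x u v * - / EE x u v))
      by (field; lra).
    rewrite sqrt_square by nra; apply sqrt_square; lra. }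
  assert (M1 := L1 u v Hp); assert (M2 := L2 u v Hp).
  assert (NP := N1 u v Hp); assert (NM := N2 u v Hp); assert (PP := P u v Hp).
  assert (GP := KP u v Hp); assert (GM := KM u v Hp).
  rewrite R4; split; [|split].
  - rewrite Q by assumption; unfold Rdiv; apply Rmult_integral_contrapositive_currified; auto.
    apply Rinv_neq_0_compat, pow_nonzero; lra.
  - rewrite (hlaplacian_ext Dom _ (fun a b => ln 16 + (-2) * ln (Rabs (dual_gram 1 x a b))
      + (-2) * ln (Rabs (dual_gram (-1) x a b)))); auto.
    + rewrite (hlaplacian_linear Dom (ln 16) (-2) (-2)), M1, M2 by auto.
      replace (K u v) with (((K u v + kappa u v) + (K u v - kappa u v)) / 2) by field.
      rewrite GP, GM.
      transitivity (8 * e * f * (dual_gram 1 x u v + dual_gram (-1) x u v)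
        / (EE x u v * (dual_gram 1 x u v * dual_gram (-1) x u v))); [field; lra|].
      rewrite PP; field; repeat split; try lra; intro Z; apply Nef; rewrite Z; ring.
    + intros a b Hab; rewrite AQ by assumption.
      assert (HEa := HE a b Hab); assert (Na := N1 a b Hab); assert (Nb := N2 a b Hab).
      (* (M + D)(M - D) = 4 e f E^2 gives 16 E^4 = (M + D)^2 (M - D)^2. *)
      replace (/ EE x a b ^ 4) with
        (16 * / (Rabs (dual_gram 1 x a b) * Rabs (dual_gram 1 x a b)
                 * (Rabs (dual_gram (-1) x a b) * Rabs (dual_gram (-1) x a b)))).
      * assert (Pa := Rabs_pos_lt _ Na); assert (Pb := Rabs_pos_lt _ Nb).
        assert (Pa2 := Rmult_lt_0_compat _ _ Pa Pa); assert (Pb2 := Rmult_lt_0_compat _ _ Pb Pb).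
        rewrite ln_mult, ln_Rinv, !ln_mult; try lra; try assumption.
        -- now apply Rmult_lt_0_compat.
        -- now apply Rinv_0_lt_compat, Rmult_lt_0_compat.
      * replace (Rabs (dual_gram 1 x a b) * Rabs (dual_gram 1 x a b)
                 * (Rabs (dual_gram (-1) x a b) * Rabs (dual_gram (-1) x a b)))
          with (Rabs (dual_gram 1 x a b * dual_gram (-1) x a b)
                * Rabs (dual_gram 1 x a b * dual_gram (-1) x a b)) by (rewrite !Rabs_mult; ring).
        rewrite P, <- Rabs_mult by assumption.
        replace (4 * e * f * EE x a b ^ 2 * (4 * e * f * EE x a b ^ 2))
          with (16 * (e * e) * (f * f) * EE x a b ^ 4) by ring.
        rewrite He, Hf, Rabs_right; [field; lra|].
        replace (EE x a b ^ 4) with ((EE x a b * EE x a b) * (EE x a b * EE x a b)) by ring.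
        nra.
  - rewrite (hlaplacian_ext Dom _ (fun a b => 0 + 1 * ln (Rabs (dual_gram 1 x a b))
      + (-1) * ln (Rabs (dual_gram (-1) x a b)))); auto.
    + rewrite (hlaplacian_linear Dom 0 1 (-1)), M1, M2 by auto.
      replace (kappa u v) with (((K u v + kappa u v) - (K u v - kappa u v)) / 2) by field.
      rewrite GP, GM.
      transitivity (4 * e * f * (dual_gram 1 x u v - dual_gram (-1) x u v)
        / (EE x u v * (dual_gram 1 x u v * dual_gram (-1) x u v))); [field; lra|].
      rewrite PP; field; repeat split; try lra; intro Z; apply Nef; rewrite Z; ring.
    + intros a b Hab; rewrite KP, KM by assumption.
      assert (HEa := HE a b Hab); assert (Na := N1 a b Hab); assert (Nb := N2 a b Hab).
      replace (- dual_gram 1 x a b / (2 * EE x a b ^ 3) / (- dual_gram (-1) x a b / (2 * EE x a b ^ 3)))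
        with (dual_gram 1 x a b * / dual_gram (-1) x a b) by (field; lra).
      assert (Pa := Rabs_pos_lt _ Na); assert (Pb := Rabs_pos_lt _ Nb).
      rewrite Rabs_mult, Rabs_inv, ln_mult, ln_Rinv; try assumption; try lra.
      now apply Rinv_0_lt_compat.
Qed.

(** * Canonical coordinates and motions *)

(** The double-number square in terms of real vectors, a form on which both
the wave equation and a motion act directly. *)
Lemma dPhi_perp2_eq (x : vfun) (u v : R) :
  dPhi_perp2 x u v
  = let P := nor_part x u v (vscal (/ 2) (vadd (vd_u (vd_u x) u v) (vd_v (vd_v x) u v))) in
    let Q := nor_part x u v (vscal (/ 2) (vadd (vd_u (vd_v x) u v) (vd_v (vd_u x) u v))) in
    Dbl (dot P P + dot Q Q) (2 * dot P Q).
Proof.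
  unfold dPhi_perp2, dbl_nor_part.
  replace (vmap dre (dPhi x u v))
    with (vscal (/ 2) (vadd (vd_u (vd_u x) u v) (vd_v (vd_v x) u v))).
  2:{ unfold dPhi, Phi, dbl_d_t, dbl_mul, dbl_add, dbl_of_R, dbl_j, vd_u, vd_v; cbn.
      vec; cbn [dre]; ring. }
  replace (vmap dim (dPhi x u v))
    with (vscal (/ 2) (vadd (vd_u (vd_v x) u v) (vd_v (vd_u x) u v))).
  2:{ unfold dPhi, Phi, dbl_d_t, dbl_mul, dbl_add, dbl_of_R, dbl_j, vd_u, vd_v; cbn.
      vec; cbn [dim]; ring. }
  cbv zeta; set (P := nor_part x u v _); set (Q := nor_part x u v _).
  unfold dbl_dot, dbl_add, dbl_opp, dbl_mul, vmap2, dot; cbn [dre dim c1 c2 c3 c4].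
  f_equal; ring.
Qed.

Lemma isothermal_wave_of_minimal (Dom : R * R -> Prop) (x : vfun) (eps : dbl) :
  minimal_general_canonical Dom x eps -> isothermal_wave Dom x.
Proof.
  intros (((HU & _) & Sx & _) & Hm & _ & Hi & _).
  split; [exact HU|]; split; [exact Sx|]; split; [exact Hi|].
  intros u v Hp; now apply (wave_equation Dom).
Qed.

(** The idempotent components of (Phi'^perp)^2 are the squares of the normal
parts of a' and b'.  These normal parts have the same squares as a' and b',
since a' is orthogonal to a, and the tangential part of a' is therefore a
multiple of the null vector a; similarly for b'. *)
Lemma unit_null_derivatives_of_canonical (Dom : R * R -> Prop) (x : vfun) (eps : dbl) :
  minimal_general_canonical Dom x eps -> unit_null_derivatives Dom x (dre eps + dim eps) (dre eps - dim eps).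
Proof.
  intros H; assert (HW := isothermal_wave_of_minimal Dom x eps H); split; auto.
  intros u v Hp; destruct H as (_ & _ & _ & _ & _ & HC); specialize (HC u v Hp).
  assert (HW' := HW); destruct HW' as (HU & Sx & Hi & Hw).
  destruct (null_derivatives Dom x u v HW Hp) as (-> & ->).
  destruct (wave_second_derivatives Dom x u v HW Hp) as (D1 & D2).
  rewrite dPhi_perp2_eq in HC; cbv zeta in HC.
  rewrite (vd_v_vd_u Dom), Hw in HC by auto.
  set (p := vd_u (vd_u x) u v) in *; set (q := vd_u (vd_v x) u v) in *.
  replace (vscal (/ 2) (vadd p p)) with p in HC by (vec; field).
  replace (vscal (/ 2) (vadd q q)) with q in HC by (vec; field).
  assert (NN : forall w z, dot (nor_part x u v w) (nor_part x u v z) = dot (nor_part x u v w) z).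
  { intros w z; rewrite (dot_nor_part Dom), (proj1 (dot_nor_part_tangent Dom x u v z Hi Hp)),
      (proj2 (dot_nor_part_tangent Dom x u v z Hi Hp)), (dot_sym w), !(dot_nor_part Dom) by auto.
    rewrite (dot_sym z w); unfold Rdiv; ring. }
  rewrite !NN, !(dot_nor_part Dom) in HC by auto.
  rewrite <- HC; cbn [dre dim]; dots.
  rewrite D1, D2, (dot_sym q p); unfold Rdiv; split; ring.
Qed.

Lemma canonical_signs (Dom : R * R -> Prop) (x : vfun) (eps : dbl) :
  minimal_general_canonical Dom x eps ->
  (dre eps + dim eps) * (dre eps + dim eps) = 1 /\
  (dre eps - dim eps) * (dre eps - dim eps) = 1.
Proof.
  intros (_ & _ & _ & _ & [(_ & ->)|[(_ & ->)|(_ & ->)]] & _); cbn; split; ring.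
Qed.

Lemma linear_map_columns (A : vec4 R -> vec4 R) (w : vec4 R) :
  linear_map A ->
  A w = vadd (vadd (vscal (c1 w) (A (Vec4 1 0 0 0))) (vscal (c2 w) (A (Vec4 0 1 0 0))))
             (vadd (vscal (c3 w) (A (Vec4 0 0 1 0))) (vscal (c4 w) (A (Vec4 0 0 0 1)))).
Proof.
  intros (Ha & Hs); rewrite <- !Hs, <- !Ha; f_equal; vec; ring.
Qed.

Lemma linear_map_vsub (A : vec4 R -> vec4 R) (a b : vec4 R) :
  linear_map A -> A (vsub a b) = vsub (A a) (A b).
Proof.
  intros (Ha & Hs); replace (vsub a b) with (vadd a (vscal (-1) b)) by (vec; ring).
  rewrite Ha, Hs; vec; ring.
Qed.

Lemma linear_map_vzero (A : vec4 R -> vec4 R) : linear_map A -> A vzero = vzero.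
Proof.
  intros (Ha & Hs); replace vzero with (vscal 0 vzero) at 1 by (vec; ring).
  rewrite Hs; vec; ring.
Qed.

(** Multiply by the determinant of the images of the standard basis, which
is 1, and use [det4_mul_det4]. *)
Lemma SO22_det4 (A : vec4 R -> vec4 R) (a b c d : vec4 R) :
  SO22 A -> det4 (A a) (A b) (A c) (A d) = det4 a b c d.
Proof.
  intros (_ & Hd & HA); unfold det_map in HA.
  rewrite <- (Rmult_1_r (det4 (A a) (A b) (A c) (A d))), <- HA, det4_mul_det4.
  unfold dots4; rewrite !Hd.
  unfold det4, det3, dot; cbn [c1 c2 c3 c4]; ring.
Qed.

Lemma vsmooth_on_linear (U : R * R -> Prop) (A : vec4 R -> vec4 R) (w : vfun) :
  open U -> linear_map A -> vsmooth_on U w -> vsmooth_on U (fun a b => A (w a b)).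
Proof.
  intros HU HA Sw.
  apply (vsmooth_on_ext U (fun a b =>
    vadd (vadd (vscal (c1 (w a b)) (A (Vec4 1 0 0 0))) (vscal (c2 (w a b)) (A (Vec4 0 1 0 0))))
         (vadd (vscal (c3 (w a b)) (A (Vec4 0 0 1 0))) (vscal (c4 (w a b)) (A (Vec4 0 0 0 1)))))); auto.
  - intros a b _; symmetry; now apply linear_map_columns.
  - vsmooth.
Qed.

Lemma vd_u_linear (U : R * R -> Prop) (A : vec4 R -> vec4 R) (w : vfun) (u v : R) :
  open U -> linear_map A -> vsmooth_on U w -> U (u, v) ->
  vd_u (fun a b => A (w a b)) u v = A (vd_u w u v).
Proof.
  intros HU HA Sw Hp; rewrite (linear_map_columns A (vd_u w u v)) by assumption.
  rewrite (vd_u_ext U _ _ u v HU (fun a b _ => linear_map_columns A (w a b) HA) Hp).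
  vderiv U.
Qed.

Lemma vd_v_linear (U : R * R -> Prop) (A : vec4 R -> vec4 R) (w : vfun) (u v : R) :
  open U -> linear_map A -> vsmooth_on U w -> U (u, v) ->
  vd_v (fun a b => A (w a b)) u v = A (vd_v w u v).
Proof.
  intros HU HA Sw Hp; rewrite (linear_map_columns A (vd_v w u v)) by assumption.
  rewrite (vd_v_ext U _ _ u v HU (fun a b _ => linear_map_columns A (w a b) HA) Hp).
  vderiv U.
Qed.

Lemma vsmooth_on_motion (U : R * R -> Prop) (A : vec4 R -> vec4 R) (b : vec4 R) (x : vfun) :
  open U -> linear_map A -> vsmooth_on U x -> vsmooth_on U (motion A b x).
Proof.
  intros HU HA Sx; apply vsmooth_on_vadd; auto; [now apply vsmooth_on_linear | vsmooth].
Qed.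

Lemma vd_u_motion (U : R * R -> Prop) (A : vec4 R -> vec4 R) (b : vec4 R) (x : vfun) (u v : R) :
  open U -> linear_map A -> vsmooth_on U x -> U (u, v) ->
  vd_u (motion A b x) u v = A (vd_u x u v).
Proof.
  intros HU HA Sx Hp; unfold motion.
  assert (Sb : vsmooth_on U (fun _ _ => b)) by vsmooth.
  rewrite (vd_u_vadd U (fun p q => A (x p q)) (fun _ _ => b)) by auto using vsmooth_on_linear.
  rewrite (vd_u_linear U) by auto; unfold vd_u at 2; rewrite !d_u_const; vec; ring.
Qed.

Lemma vd_v_motion (U : R * R -> Prop) (A : vec4 R -> vec4 R) (b : vec4 R) (x : vfun) (u v : R) :
  open U -> linear_map A -> vsmooth_on U x -> U (u, v) ->
  vd_v (motion A b x) u v = A (vd_v x u v).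
Proof.
  intros HU HA Sx Hp; unfold motion.
  assert (Sb : vsmooth_on U (fun _ _ => b)) by vsmooth.
  rewrite (vd_v_vadd U (fun p q => A (x p q)) (fun _ _ => b)) by auto using vsmooth_on_linear.
  rewrite (vd_v_linear U) by auto; unfold vd_v at 2; rewrite !d_v_const; vec; ring.
Qed.

(** All the quantities attached to the moved surface are built from these
derivatives, so A can be pulled out of them. *)
Lemma second_derivatives_motion (U : R * R -> Prop) (A : vec4 R -> vec4 R) (b : vec4 R)
    (x : vfun) (u v : R) :
  open U -> linear_map A -> vsmooth_on U x -> U (u, v) ->
  vd_u (vd_u (motion A b x)) u v = A (vd_u (vd_u x) u v) /\
  vd_u (vd_v (motion A b x)) u v = A (vd_u (vd_v x) u v) /\
  vd_v (vd_u (motion A b x)) u v = A (vd_v (vd_u x) u v) /\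
  vd_v (vd_v (motion A b x)) u v = A (vd_v (vd_v x) u v).
Proof.
  intros HU HA Sx Hp.
  assert (Su := vsmooth_on_vd_u U x Sx); assert (Sv := vsmooth_on_vd_v U x Sx).
  assert (Eu := fun p q => vd_u_motion U A b x p q HU HA Sx).
  assert (Ev := fun p q => vd_v_motion U A b x p q HU HA Sx).
  rewrite (vd_u_ext U _ _ u v HU Eu Hp), (vd_u_ext U _ _ u v HU Ev Hp),
    (vd_v_ext U _ _ u v HU Eu Hp), (vd_v_ext U _ _ u v HU Ev Hp).
  rewrite !(vd_u_linear U), !(vd_v_linear U) by auto; auto.
Qed.

Lemma metric_motion (U : R * R -> Prop) (A : vec4 R -> vec4 R) (b : vec4 R) (x : vfun) (u v : R) :
  open U -> SO22 A -> vsmooth_on U x -> U (u, v) ->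
  EE (motion A b x) u v = EE x u v /\ FF (motion A b x) u v = FF x u v /\
  GG (motion A b x) u v = GG x u v.
Proof.
  intros HU (HA & Hd & _) Sx Hp; unfold EE, FF, GG.
  rewrite (vd_u_motion U), (vd_v_motion U), !Hd by auto; auto.
Qed.

Lemma nor_part_motion (U : R * R -> Prop) (A : vec4 R -> vec4 R) (b : vec4 R) (x : vfun)
    (u v : R) (w : vec4 R) :
  open U -> SO22 A -> vsmooth_on U x -> U (u, v) ->
  nor_part (motion A b x) u v (A w) = A (nor_part x u v w).
Proof.
  intros HU HS Sx Hp; unfold nor_part, tan_part; cbv zeta.
  destruct (metric_motion U A b x u v HU HS Sx Hp) as (-> & -> & ->).
  destruct HS as (HA & Hd & _).
  rewrite (vd_u_motion U), (vd_v_motion U), !Hd by auto.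
  rewrite linear_map_vsub by assumption.
  destruct HA as (Ha & Hs); rewrite Ha, !Hs; reflexivity.
Qed.

Lemma push_motion (U : R * R -> Prop) (A : vec4 R -> vec4 R) (b : vec4 R) (x : vfun)
    (X : tfield) (u v : R) :
  open U -> linear_map A -> vsmooth_on U x -> U (u, v) ->
  push (motion A b x) X u v = A (push x X u v).
Proof.
  intros HU HA Sx Hp; unfold push; rewrite (vd_u_motion U), (vd_v_motion U) by auto.
  destruct HA as (Ha & Hs); now rewrite Ha, !Hs.
Qed.

Lemma tangent_frame_motion (Dom : R * R -> Prop) (A : vec4 R -> vec4 R) (b : vec4 R) (x : vfun)
    (X1 X2 : tfield) (u v : R) :
  open Dom -> SO22 A -> vsmooth_on Dom x -> Dom (u, v) ->
  tangent_frame_near x X1 X2 u v -> tangent_frame_near (motion A b x) X1 X2 u v.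
Proof.
  intros HU (HA & Hd & _) Sx Hp HF; unfold tangent_frame_near.
  apply locally_2d_impl with (2 := locally_2d_and _ _ u v HF (open_locally_2d Dom u v HU Hp)).
  apply locally_2d_forall; intros p q (HF' & Hpq).
  rewrite !(push_motion Dom), !Hd by auto; exact HF'.
Qed.

Lemma normal_frame_motion (Dom : R * R -> Prop) (A : vec4 R -> vec4 R) (b : vec4 R) (x : vfun)
    (n1 n2 : vfun) (u v : R) :
  open Dom -> SO22 A -> vsmooth_on Dom x -> Dom (u, v) ->
  normal_frame_near x n1 n2 u v ->
  normal_frame_near (motion A b x) (fun p q => A (n1 p q)) (fun p q => A (n2 p q)) u v.
Proof.
  intros HU (HA & Hd & _) Sx Hp HF.
  destruct (locally_2d_open _ u v (locally_2d_and _ _ u v HF (open_locally_2d Dom u v HU Hp)))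
    as (U & OU & Up & PU).
  assert (T1 : vsmooth_on U n1) by (intros p q Hpq; apply (PU p q Hpq)).
  assert (T2 : vsmooth_on U n2) by (intros p q Hpq; apply (PU p q Hpq)).
  unfold normal_frame_near.
  apply locally_2d_impl with (2 := open_locally_2d U u v OU Up).
  apply locally_2d_forall; intros p q Hpq; destruct (PU p q Hpq) as (HF' & Dpq).
  rewrite (vd_u_motion Dom), (vd_v_motion Dom), !Hd by auto.
  split; [|exact (proj2 HF')].
  split; apply (vsmooth_on_linear U A); auto.
Qed.

Lemma right_oriented_motion (Dom : R * R -> Prop) (A : vec4 R -> vec4 R) (b : vec4 R) (x : vfun)
    (X1 X2 : tfield) (n1 n2 : vfun) (u v : R) :
  open Dom -> SO22 A -> vsmooth_on Dom x -> Dom (u, v) ->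
  right_oriented_near x X1 X2 n1 n2 u v ->
  right_oriented_near (motion A b x) X1 X2 (fun p q => A (n1 p q)) (fun p q => A (n2 p q)) u v.
Proof.
  intros HU HS Sx Hp HF; unfold right_oriented_near.
  apply locally_2d_impl with (2 := locally_2d_and _ _ u v HF (open_locally_2d Dom u v HU Hp)).
  apply locally_2d_forall; intros p q (HF' & Hpq).
  rewrite !(push_motion Dom), SO22_det4 by (auto; apply HS); exact HF'.
Qed.

Lemma minimal_motion (Dom : R * R -> Prop) (A : vec4 R -> vec4 R) (b : vec4 R) (x : vfun) :
  open Dom -> SO22 A -> vsmooth_on Dom x -> minimal Dom x -> minimal Dom (motion A b x).
Proof.
  intros HU HS Sx Hm u v Hp; destruct (Hm u v Hp) as (X1 & X2 & HF & HM).
  exists X1, X2; split; [now apply (tangent_frame_motion Dom)|].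
  destruct (locally_2d_open _ u v (locally_2d_and _ _ u v HF (open_locally_2d Dom u v HU Hp)))
    as (U & OU & Up & PU).
  assert (UD : forall p q, U (p, q) -> Dom (p, q)) by (intros p q Hpq; apply (PU p q Hpq)).
  assert (SxU : vsmooth_on U x) by (intros p q Hpq; apply (Sx p q (UD p q Hpq))).
  assert (S1 : tfield_smooth_on U X1) by (split; intros p q Hpq; apply (PU p q Hpq)).
  assert (S2 : tfield_smooth_on U X2) by (split; intros p q Hpq; apply (PU p q Hpq)).
  assert (HA := proj1 HS).
  assert (E : forall X Y : tfield, tfield_smooth_on U Y ->
    second_form (motion A b x) X Y u v = A (second_form x X Y u v)).
  { intros X Y SY; unfold second_form.
    assert (SP : vsmooth_on U (push x Y)) by (now apply (vsmooth_on_vdir U Y x)).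
    rewrite (vdir_ext U X _ (fun p q => A (push x Y p q))) by
      (auto; intros; now apply (push_motion U)).
    rewrite <- (nor_part_motion U A b) by auto; f_equal.
    unfold vdir; rewrite (vd_u_linear U), (vd_v_linear U) by auto.
    destruct HA as (Ha & Hs); now rewrite Ha, !Hs. }
  unfold mean_curvature in *; rewrite !E, <- linear_map_vsub, <- (proj2 HA), HM by auto.
  now apply linear_map_vzero.
Qed.

Lemma time_like_motion (Dom : R * R -> Prop) (A : vec4 R -> vec4 R) (b : vec4 R) (x : vfun) :
  SO22 A -> time_like_surface Dom x -> time_like_surface Dom (motion A b x).
Proof.
  intros HS ((HU & HC) & Sx & HT); assert (HA := proj1 HS).
  split; [split; assumption|]; split; [now apply vsmooth_on_motion|].
  intros u v Hp; destruct (HT u v Hp) as (Him & p & q & r & s & Hind).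
  assert (E : forall k l, vadd (vscal k (vd_u (motion A b x) u v)) (vscal l (vd_v (motion A b x) u v))
    = A (vadd (vscal k (vd_u x u v)) (vscal l (vd_v x u v))))
    by (intros k l; exact (push_motion Dom A b x ((fun _ _ => k), (fun _ _ => l)) u v HU HA Sx Hp)).
  destruct HS as (_ & Hd & _).
  split.
  - intros k l Hkl; apply Him; rewrite E in Hkl.
    set (w := vadd (vscal k (vd_u x u v)) (vscal l (vd_v x u v))) in *.
    assert (Z : forall z, dot w z = 0).
    { intros z; rewrite <- Hd, Hkl; unfold dot, vzero; cbn [c1 c2 c3 c4]; ring. }
    assert (Z1 := Z (Vec4 1 0 0 0)); assert (Z2 := Z (Vec4 0 1 0 0));
    assert (Z3 := Z (Vec4 0 0 1 0)); assert (Z4 := Z (Vec4 0 0 0 1)).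
    unfold dot in Z1, Z2, Z3, Z4; cbn [c1 c2 c3 c4] in Z1, Z2, Z3, Z4.
    apply vec4_ext; unfold vzero; cbn [c1 c2 c3 c4]; lra.
  - exists p, q, r, s; cbv zeta in *; rewrite !E, !Hd; exact Hind.
Qed.

Lemma dPhi_perp2_motion (Dom : R * R -> Prop) (A : vec4 R -> vec4 R) (b : vec4 R) (x : vfun)
    (u v : R) :
  open Dom -> SO22 A -> vsmooth_on Dom x -> Dom (u, v) ->
  dPhi_perp2 (motion A b x) u v = dPhi_perp2 x u v.
Proof.
  intros HU HS Sx Hp; rewrite !dPhi_perp2_eq; cbv zeta.
  destruct (second_derivatives_motion Dom A b x u v HU (proj1 HS) Sx Hp) as (-> & -> & -> & ->).
  assert (HS' := HS); destruct HS' as ((Ha & Hs) & Hd & _).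
  rewrite <- !Ha, <- !Hs, !(nor_part_motion Dom), !Hd by assumption.
  reflexivity.
Qed.

Lemma minimal_general_canonical_motion (Dom : R * R -> Prop) (A : vec4 R -> vec4 R) (b : vec4 R)
    (x : vfun) (eps : dbl) :
  SO22 A -> minimal_general_canonical Dom x eps ->
  minimal_general_canonical Dom (motion A b x) eps.
Proof.
  intros HS (HT & Hm & Hg & Hi & Ht & Hc); assert (HT' := HT); destruct HT' as ((HU & _) & Sx & _).
  assert (P := fun u v => dPhi_perp2_motion Dom A b x u v HU HS Sx).
  split; [now apply time_like_motion|]; split; [now apply minimal_motion|].
  split; [intros u v Hp; rewrite P by auto; now apply Hg|].
  split; [|split].
  - intros u v Hp; destruct (metric_motion Dom A b x u v HU HS Sx Hp) as (-> & -> & ->).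
    now apply Hi.
  - destruct Ht as [(Ht & He)|[(Ht & He)|(Ht & He)]]; [left|right; left|right; right];
      (split; [|exact He]); intros u v Hp; rewrite P by auto; now apply Ht.
  - intros u v Hp; rewrite P by auto; now apply Hc.
Qed.

Lemma curvature_exprs_motion (Dom : R * R -> Prop) (A : vec4 R -> vec4 R) (b : vec4 R) (x : vfun) (u v : R) :
  SO22 A -> isothermal_wave Dom x -> isothermal_wave Dom (motion A b x) -> Dom (u, v) ->
  gauss_curvature_expr (motion A b x) u v = gauss_curvature_expr x u v /\
  normal_curvature_expr (motion A b x) u v = normal_curvature_expr x u v.
Proof.
  intros HS HW HW' Hp; assert (HU := proj1 HW); assert (Sx := proj1 (proj2 HW)).
  unfold gauss_curvature_expr, normal_curvature_expr.
  destruct (null_derivatives Dom _ u v HW Hp) as (-> & ->).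
  destruct (null_derivatives Dom _ u v HW' Hp) as (-> & ->).
  destruct (metric_motion Dom A b x u v HU HS Sx Hp) as (-> & _).
  destruct (second_derivatives_motion Dom A b x u v HU (proj1 HS) Sx Hp) as (-> & -> & _).
  unfold null_plus, null_minus.
  rewrite (vd_u_motion Dom), (vd_v_motion Dom) by (auto; apply HS).
  rewrite <- !(linear_map_vsub A), <- !(proj1 (proj1 HS)) by apply HS.
  unfold gram2; rewrite (SO22_det4 A) by assumption.
  destruct HS as (_ & Hd & _); rewrite !Hd; auto.
Qed.

Theorem theorem7p4 (Dom : R * R -> Prop) (x : vfun) (eps : dbl)
    (K kappa : R -> R -> R)
    (Hx : minimal_general_canonical Dom x eps)
    (HK : is_gauss_curvature Dom x K)
    (Hkappa : is_normal_curvature Dom x kappa) :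
  solves_system Dom K kappa /\
  forall (A : vec4 R -> vec4 R) (b : vec4 R),
    SO22 A ->
    minimal_general_canonical Dom (motion A b x) eps /\
    is_gauss_curvature Dom (motion A b x) K /\
    is_normal_curvature Dom (motion A b x) kappa /\
    forall Kh kappah : R -> R -> R,
      is_gauss_curvature Dom (motion A b x) Kh ->
      is_normal_curvature Dom (motion A b x) kappah ->
      forall u v, Dom (u, v) -> Kh u v = K u v /\ kappah u v = kappa u v.
Proof.
  assert (GV : forall y k, isothermal_wave Dom y -> is_gauss_curvature Dom y k ->
    forall u v, Dom (u, v) -> k u v = gauss_curvature_expr y u v).
  { intros y k HW Hk u v Hp; destruct (Hk u v Hp) as (X1 & X2 & HF & ->).
    now apply (gauss_value Dom). }
  assert (NV : forall y k, isothermal_wave Dom y -> is_normal_curvature Dom y k ->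
    forall u v, Dom (u, v) -> k u v = normal_curvature_expr y u v).
  { intros y k HW Hk u v Hp; destruct (Hk u v Hp) as (X1 & X2 & n1 & n2 & HF & HN & HO & ->).
    now apply (normal_value Dom). }
  assert (HW := isothermal_wave_of_minimal Dom x eps Hx).
  split.
  { destruct (canonical_signs Dom x eps Hx) as (He & Hf).
    apply (system_of_unit_null_derivatives Dom x _ _ K kappa (unit_null_derivatives_of_canonical Dom x eps Hx) He Hf); auto. }
  intros A b HS.
  assert (Hy := minimal_general_canonical_motion Dom A b x eps HS Hx).
  assert (HW' := isothermal_wave_of_minimal Dom _ eps Hy).
  assert (HU := proj1 HW); assert (Sx := proj1 (proj2 HW)).
  assert (FM := fun u v => curvature_exprs_motion Dom A b x u v HS HW HW').
  split; [exact Hy|]; split; [|split].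
  - intros u v Hp; destruct (HK u v Hp) as (X1 & X2 & HF & _); exists X1, X2.
    assert (HF' := tangent_frame_motion Dom A b x X1 X2 u v HU HS Sx Hp HF).
    split; [exact HF'|].
    rewrite (gauss_value Dom), (proj1 (FM u v Hp)) by assumption; auto.
  - intros u v Hp; destruct (Hkappa u v Hp) as (X1 & X2 & n1 & n2 & HF & HN & HO & _).
    exists X1, X2, (fun p q => A (n1 p q)), (fun p q => A (n2 p q)).
    assert (HF' := tangent_frame_motion Dom A b x X1 X2 u v HU HS Sx Hp HF).
    assert (HN' := normal_frame_motion Dom A b x n1 n2 u v HU HS Sx Hp HN).
    assert (HO' := right_oriented_motion Dom A b x X1 X2 n1 n2 u v HU HS Sx Hp HO).
    split; [exact HF'|]; split; [exact HN'|]; split; [exact HO'|].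
    etransitivity; [|symmetry; exact (normal_value Dom _ _ _ _ _ u v HW' Hp HF' HN' HO')].
    rewrite (proj2 (FM u v Hp)); auto.
  - intros Kh kh HKh Hkh u v Hp.
    rewrite (GV _ Kh HW' HKh u v Hp), (NV _ kh HW' Hkh u v Hp), (GV _ K HW HK u v Hp),
      (NV _ kappa HW Hkappa u v Hp).
    now apply FM.
Qed.
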